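(* Let $0<\delta,\kappa<1$. There is a constant $c=c(\delta,\kappa)>0$ such that for every $q\in(2,3)$ and every $K>0$ there exist $\eta_0>0$ and $N_0$ with the following property. Let $0<\eta\le\eta_0$, let $N\ge N_0$ be an integer, and put $N_3=N$, $N_1=N_2=\lfloor N/2\rfloor$. For $i=1,2,3$ let $\nu_i,a_i:[1,N_i]\to\mathbb{R}$ be functions (on the integers in $[1,N_i]$), and let $\alpha_i=\frac1{N_i}\sum_{n=1}^{N_i}a_i(n)$. Suppose that: (1) $0\le a_i(n)\le \nu_i(n)$ for all $1\le n\le N_i$ and $i=1,2,3$; (2) $\alpha_i\ge\delta$ for $i=1,2,3$, and $\tfrac12\bigl(\min(1,\alpha_1+\alpha_2)+\alpha_2\bigr)+\alpha_3\ge 1+\delta$; (3) each $\nu_i$ is $\eta$-pseudorandom (as a function on $[1,N_i]$); (4) each $a_i$ satisfies the $L^q$ extension estimate with constant $K$ (as a function on $[1,N_i]$); (5) $a_1$ is $(\delta/50,\kappa)$-regular (as a function on $[1,N_1]$). Then $$\sum_{\substack{n_1,n_2,n_3\\ n_1+n_2+n_3=N}}a_1(n_1)a_2(n_2)a_3(n_3)\ge cN^2,$$ where the sum is over $n_i\in[1,N_i]\cap\mathbb{Z}$.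
   Context: Notation: $e(x)=\exp(2\pi i x)$. A function $f:[1,N]\to\mathbb{R}$ (defined on integers in $[1,N]$) is extended by $0$ to $\mathbb{Z}$; its Fourier transform is $\hat f(\theta)=\sum_{n\in\mathbb{Z}}f(n)e(n\theta)$ and $\|\hat f\|_q=\left(\int_0^1|\hat f(\theta)|^q\,d\theta\right)^{1/q}$. For real $y\ge2$, $P(y)$ is the product of all primes $p\le y$. Definitions, for $f:[1,N]\to\mathbb{R}$: - $f$ is $\eta$-pseudorandom if $|\hat f(r/N)-\delta_{r,0}N|\le\eta N$ for each $r\in\mathbb{Z}/N\mathbb{Z}$, where $\delta_{r,0}$ is the Kronecker delta. - $f$ satisfies the $L^q$ extension estimate with constant $K$ if $\|\hat f\|_q\le K N^{1-1/q}$. - For $0<\beta,\kappa<1$, $f$ is $(\beta,\kappa)$-regular if $\sum_{(u,v)\in M}f(u)f(v)\ge\kappa N^2$, where $M=\{(u,v)\in([1,N]\cap\mathbb{Z})^2: u\le\beta N,\ v\ge(1-\beta)N,\ \gcd(v-u,P(\beta^{-1}))=1\}$. *)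

(* Defs.v *)
From mathcomp Require Import all_boot all_order all_algebra.
From mathcomp Require Export complex.
From mathcomp Require Import all_classical all_reals all_analysis.

Set Implicit Arguments.
Unset Strict Implicit.
Unset Printing Implicit Defensive.

Import Order.TTheory GRing.Theory Num.Theory.
Import numFieldNormedType.Exports.

Local Open Scope classical_set_scope.
Local Open Scope ring_scope.
Local Open Scope complex_scope.

(* A function on the integers of [1, N] is represented by f : nat -> R together
   with N.  Only the values f 1, ..., f N are ever used, so the extension of f
   by 0 outside [1, N] is built into the range of summation. *)

Section Definitions.
Context {R : realType}.
Implicit Types (N : nat) (f : nat -> R).

Definition modulus (z : R[i]) : R := ComplexField.Normc.normc z.

Definition e (x : R) : R[i] := cos (2 * pi * x) +i* sin (2 * pi * x).

Definition fourier N f (theta : R) : R[i] :=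
  \sum_(1 <= n < N.+1) (f n)%:C * e (n%:R * theta).

(* The integrand is continuous on [0, 1], so the real-valued integral is the
   genuine Lebesgue integral. *)
Definition fourier_norm N f (q : R) : R :=
  (\int[lebesgue_measure]_(theta in `[0%R, 1%R])
     modulus (fourier N f theta) `^ q) `^ (1 / q).

Definition mean N f : R := (\sum_(1 <= n < N.+1) f n) / N%:R.

(* Z/NZ is represented by the residues 0, ..., N - 1. *)
Definition pseudorandom N f (eta : R) : Prop :=
  forall r : nat, (r < N)%N ->
    modulus (fourier N f (r%:R / N%:R) - ((r == 0%N)%:R * N%:R)%:C)
      <= eta * N%:R.

Definition extension_estimate N f (q K : R) : Prop :=
  fourier_norm N f q <= K * N%:R `^ (1 - 1 / q).

(* For y >= 0 and p natural, p <= y if and only if p < (truncn y).+1. *)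
Definition primorial (y : R) : nat :=
  (\prod_(0 <= p < (Num.truncn y).+1 | prime p) p)%N.

Definition regular N f (beta kappa : R) : Prop :=
  \sum_(1 <= u < N.+1) \sum_(1 <= v < N.+1 |
      [&& u%:R <= beta * N%:R, (1 - beta) * N%:R <= v%:R
        & gcdz (v%:Z - u%:Z) (primorial beta^-1)%:Z == 1])
    f u * f v >= kappa * N%:R ^+ 2.

End Definitions.

(* Main.v *)
Require Import Defs.
From mathcomp Require Import all_boot all_order all_algebra.
From mathcomp Require Import all_classical all_reals all_analysis.
From mathcomp Require Import fingroup ring lra zify.

Import Order.TTheory GRing.Theory Num.Theory.

Local Open Scope ring_scope.

(** * Popular sums in a finite abelian group *)

(** The proof is by transference: each $a_i$ is replaced by a bounded function with nearly the same
    weighted count of solutions, and bounded functions are treated by a sumset argument.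

    Smoothing averages $a_i$ over shifts by $X-X$, where $X$ is a set of multiples of a fixed $P$ (a
    primorial) inside $[0,L]$ and $L$ is a small multiple of $N$. Pseudorandomness bounds the result
    pointwise by $1+\rho$ ([smooth_le]). The set $X$ comes from pigeonholing, so that the multiplier
    $|\hat X|^2/|X|^2$ is close to 1 on the large spectrum of $a_1$, whose size is bounded by the
    $L^q$ estimate; off that spectrum $\hat a_1$ is small and, because $q<3$, the $L^q$ estimates
    control the triple product ([spectral_smoothing], [smooth_triple_error]). Regularity survives
    because shifts by multiples of $P$ do not alter coprimality to $P$ ([smooth_regular]).

    Bounded functions are replaced by level sets $A,B,C$ ([dense_functions]), for which [dense_sets]
    proves a robust analogue of Freiman's $3k-3$ theorem: about $\min(W,|A|+|B|)+|B|$ integers have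
    many representations $a+b$. Regularity provides $u<v$ in $A$ near opposite ends of the interval,
    with $m=v-u$ free of small primes. Modulo $m$ there is no large proper subgroup, and a
    Pollard-type bound obtained from the Dyson transform yields about $\min(m,|A|+|B|)$ popular
    residues ([card_popular]). For most $b\in B$ both $u+b$ and $v+b=u+b+m$ are popular, so their
    residue class carries two popular sums; this contributes the extra $|B|$. Condition (2) then
    makes the popular sums and $Z-C$ too numerous to be disjoint, where $Z$ is the target sum.

    The constants of the combinatorial half depend on $\delta,\kappa$ only; $q$ and $K$ enter only
    through the density of $X$, hence only $\eta_0$ depends on them. *)

Section PopularSums.
Variable G : finZmodType.
Implicit Types (A B C Y : {set G}) (x y : G).

Definition triples A B C : nat :=
  \sum_(p : G * G) [&& p.1 \in A, p.2 \in B & (p.1 + p.2)%R \in C].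

(** With [dyson_inter], this is the Dyson transform of the pair at [x]: $A\cup(B+x)$ and
    $B\cap(A-x)$. *)
Definition dyson_union A B x : {set G} := [set y | (y \in A) || (y - x \in B)].
Definition dyson_inter A B x : {set G} := [set y | (y \in B) && (y + x \in A)].

(** The involution $(a,b)\mapsto(b+x,a-x)$ preserves $a+b$. Summing over a pair and its image
    doubles both counts, and the inequality then holds orbit by orbit. *)
Lemma triples_dyson A B C x :
  (triples (dyson_union A B x) (dyson_inter A B x) C <= triples A B C)%N.
Proof.
rewrite -leq_double -!addnn {1 3}/triples.
pose s (p : G * G) := (p.2 + x, p.1 - x).
have sK : involutive s by case=> a b; rewrite /s /= subrK addrK.
have symm A' B' : triples A' B' C =
    (\sum_(p : G * G) [&& (s p).1 \in A', (s p).2 \in B' & (p.1 + p.2)%R \in C])%N.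
  rewrite /triples (reindex_inj (inv_inj sK)); apply: eq_bigr => -[a b] _ /=.
  by rewrite addrACA subrr addr0 addrC.
rewrite (symm A B) (symm (dyson_union _ _ _)) -!big_split /=.
apply: leq_sum => -[a b] _ /=; rewrite !inE subrK addrK.
by case: (a \in A); case: (a - x \in B); case: (b \in B);
  case: (b + x \in A); case: (a + b \in C).
Qed.

Lemma card_translate A x : #|[set y | y + x \in A]| = #|A|.
Proof.
rewrite -[RHS](card_preimset A (addIr x)).
by apply: eq_card => y; rewrite !inE.
Qed.

Lemma card_dyson A B x :
  (#|dyson_union A B x| + #|dyson_inter A B x| = #|A| + #|B|)%N.
Proof.
have -> : dyson_union A B x = A :|: [set y | y + - x \in B].
  by apply/setP=> y; rewrite !inE.
rewrite -(card_translate (dyson_inter A B x) (- x)).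
have -> : [set y | y - x \in dyson_inter A B x] = A :&: [set y | y + - x \in B].
  by apply/setP=> y; rewrite !inE subrK andbC.
by rewrite cardsUI card_translate.
Qed.

Lemma card_setI_ge A B : (#|A| + #|B| <= #|A :&: B| + #|G|)%N.
Proof. by rewrite -cardsUI addnC leq_add2l max_card. Qed.

(** For each $b\in B$, the sets $A$ and $C-b$ share at least $|A|+|C|-|G|$ elements; truncated
    subtraction absorbs the case where this is negative. *)
Lemma triples_ge A B C (t : nat) : (t <= #|B|)%N ->
  (t * (#|A| + #|C|) <= triples A B C + t * #|G|)%N.
Proof.
move=> tB; rewrite /triples.
have -> : (\sum_(p : G * G) [&& p.1 \in A, p.2 \in B & (p.1 + p.2)%R \in C])%N =
    (\sum_(b in B) #|A :&: [set a | (a + b)%R \in C]|)%N.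
  rewrite -(pair_bigA _ (fun a b => nat_of_bool [&& a \in A, b \in B & (a + b)%R \in C])) /=.
  rewrite exchange_big /= [RHS]big_mkcond /=; apply: eq_bigr => b _.
  case: ifP => bB; last by rewrite big1 // => a _; rewrite andbF.
  rewrite -sum1_card [RHS]big_mkcond; apply: eq_bigr => a _ /=.
  by rewrite !inE; case: (a \in A); case: (a + b \in C).
set s := (\sum_(b in B) _)%N.
have : (#|B| * (#|A| + #|C| - #|G|) <= s)%N.
  rewrite -sum_nat_const; apply: leq_sum => b _.
  by have := card_setI_ge A [set a | a + b \in C]; rewrite card_translate; lia.
have := leq_mul tB (leqnn (#|A| + #|C| - #|G|)).
rewrite mulnBr; lia.
Qed.


(** A measure of how far [A] is from being invariant under translation by [x]. It is symmetric and
    subadditive in [x], so near-invariance propagates through sums of shifts, while its total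
    $|A|(|G|-|A|)$ forbids near-invariance under all of $G$. *)
Definition shift_defect A x : nat := #|A :\: [set y | y - x \in A]|.

Lemma shift_defectD A x y :
  (shift_defect A (x + y)%R <= shift_defect A x + shift_defect A y)%N.
Proof.
rewrite /shift_defect -(card_translate (A :\: [set z | z - y \in A]) (- x)).
set D := A :\: [set z | z - x \in A]; set E := [set z | z + - x \in _].
apply: (@leq_trans #|D :|: E|); last by rewrite -cardsUI leq_addr.
apply: subset_leq_card; apply/fintype.subsetP => z; rewrite !inE opprD addrA.
by case/andP=> h1 h2; rewrite ?h1 ?h2; case: (z - x \in A).
Qed.

Lemma shift_defectN A x : shift_defect A (- x) = shift_defect A x.
Proof.
rewrite /shift_defect.
have cardE B : #|A :\: B| = (#|A| - #|A :&: B|)%N by rewrite cardsD.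
rewrite !cardE; congr (_ - _)%N.
rewrite -(card_translate (A :&: _) (- x)); apply: eq_card => y.
by rewrite !inE opprK subrK andbC.
Qed.

Lemma shift_defect0 A : shift_defect A 0 = 0%N.
Proof.
apply/eqP; rewrite cards_eq0; apply/eqP/setP=> y.
by rewrite !inE subr0 andNb.
Qed.

Lemma sum_shift_defect A :
  (\sum_x shift_defect A x = #|A| * (#|G| - #|A|))%N.
Proof.
rewrite /shift_defect.
transitivity (\sum_(y in A) #|[set x | (y - x)%R \notin A]|)%N.
  rewrite (eq_bigr (fun x => \sum_y nat_of_bool ((y \in A) && ((y - x)%R \notin A)))%N).
    rewrite exchange_big /= [RHS]big_mkcond; apply: eq_bigr => y _ /=.
    case: ifP => yA; last by rewrite big1.
    by rewrite -sum1_card [RHS]big_mkcond; apply: eq_bigr => x _; rewrite inE; case: ifP.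
  move=> x _; rewrite -sum1_card [LHS]big_mkcond; apply: eq_bigr => y _.
  by rewrite !inE andbC; case: ifP.
rewrite -sum_nat_const; apply: eq_bigr => y _.
have -> : (#|G| - #|A| = #|~: A|)%N by rewrite [RHS]cardsCs finset.setCK.
rewrite -[RHS](card_preimset (~: A) (subrI y)).
by apply: eq_card => x; rewrite !inE.
Qed.

(* If all translates of B by the elements of a set of size about #|A| lie in A,
   then A is nearly invariant under the differences of elements of B. *)
Lemma shift_defect_diff A B Y b b' : b \in B -> b' \in B ->
  (forall y c, y \in Y -> c \in B -> c + y \in A) ->
  (shift_defect A (b - b')%R + #|Y| <= #|A|)%N.
Proof.
move=> bB b'B YA; rewrite /shift_defect cardsD.
suff: (#|Y| <= #|A :&: [set y | (y - (b - b'))%R \in A]|)%N.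
  by have := subset_leq_card (finset.subsetIl A [set y | (y - (b - b'))%R \in A]); lia.
rewrite -(card_translate Y (- b)); apply: subset_leq_card; apply/fintype.subsetP => z.
rewrite !inE => zY; rewrite -{1}(subrK b z) addrC YA //=.
by rewrite opprB addrCA YA.
Qed.

(* The iterated Dyson transform stops at such a pair. *)
Lemma dyson_terminal A B (t : nat) : (t <= #|B|)%N ->
  exists A' B' : {set G},
  [/\ (#|A'| + #|B'| = #|A| + #|B|)%N, (t <= #|B'|)%N, (#|A| <= #|A'|)%N,
      (forall C, (triples A' B' C <= triples A B C)%N) &
      forall x, (forall b, b \in B' -> b + x \in A') \/
                (#|dyson_inter A' B' x| < t)%N].
Proof.
have [n] := ubnP #|B|; elim: n => // n IHn in A B * => Bn tB.
(* A transform at such an [x] strictly shrinks [B] but leaves at least [t] elements, so the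
   induction on $|B|$ applies. *)
have [/existsP[x /andP[tx xB]]|/existsPn noX] :=
    boolP [exists x, (t <= #|dyson_inter A B x|)%N && (#|dyson_inter A B x| < #|B|)%N].
  have [||A' [B' [cAB tB' AA' trAB final]]] :=
      IHn (dyson_union A B x) (dyson_inter A B x); [lia|by []|].
  exists A', B'; split => //.
  - by rewrite cAB card_dyson.
  - by have := card_dyson A B x; lia.
  - by move=> C; apply: leq_trans (trAB C) (triples_dyson _ _ _ _).
exists A, B; split => // x; have := noX x; rewrite negb_and -!ltnNge ltnS.
case/orP => [?|Bx]; [by right|left => b bB].
have sub : dyson_inter A B x \subset B.
  by apply/fintype.subsetP => y; rewrite !inE => /andP[].
have /eqP E : dyson_inter A B x == B by rewrite eqEcard sub Bx.
by move: bB; rewrite -{1}E !inE => /andP[].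
Qed.


(** * A Pollard-type bound in groups without large proper subgroups *)

Section NoLargeSubgroup.
Variables (R : realFieldType) (beta : R).
Hypothesis beta_gt0 : 0 < beta.
Hypothesis no_subgroup : forall H : {set G}, 0 \in H ->
  {in H &, forall x y, x + y \in H} ->
  beta * #|G|%:R < #|H|%:R -> forall x, x \in H.

(* The sets K j of shifts of defect at most j d are nested, and K i + K j is
   contained in K (i + j).  An element of K (j + 2) outside K (j + 1) yields a
   translate of B inside K (j + 3) and disjoint from K j, so the sequence must
   pause; a pause is stable under B - B, hence is everything. *)
Lemma shift_defect_spread A B (d : R) (J : nat) : 0 <= d -> 1 < J%:R * beta ->
  beta * #|G|%:R < #|B|%:R ->
  (forall b b', b \in B -> b' \in B -> (shift_defect A (b - b'))%:R <= d) ->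
  forall x, (shift_defect A x)%:R <= (3 * J)%:R * d.
Proof.
move=> d0 Jbeta bigB defB.
have n0 : 0 < #|G|%:R :> R by rewrite ltr0n (cardD1 0).
pose K j := [set x | (shift_defect A x)%:R <= j%:R * d].
have K0 j : 0 \in K j by rewrite inE shift_defect0 mulr_ge0.
have KD j l x y : x \in K j -> y \in K l -> x + y \in K (j + l)%N.
  rewrite !inE => xj yl; have := shift_defectD A x y.
  rewrite -(ler_nat R) => /le_trans; apply.
  by rewrite !natrD mulrDl lerD.
have KN j x : (- x \in K j) = (x \in K j) by rewrite !inE shift_defectN.
have BK b b' : b \in B -> b' \in B -> b - b' \in K 1%N.
  by move=> bB b'B; rewrite inE mul1r defB.
have [b0 b0B] : exists b0, b0 \in B.
  apply/set0Pn; rewrite -card_gt0 -(ltr0n R); apply: lt_trans bigB.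
  by rewrite mulr_gt0.
have Ksub j l : (j <= l)%N -> K j \subset K l.
  move=> jl; apply/fintype.subsetP => x; rewrite !inE => /le_trans; apply.
  by rewrite ler_wpM2r // ler_nat.
(* Without a pause, each block of three steps gains at least $\beta|G|$ elements, and [J] blocks
   overfill $G$ since $J\beta>1$. *)
have [i iJ Kpause] : exists2 i, (i < J)%N & K (3 * i).+2 \subset K (3 * i).+1.
  apply: contrapT => noi.
  have grow r : (r <= J)%N -> r%:R * (beta * #|G|%:R) <= #|K (3 * r)%N|%:R.
    elim: r => [_|r IHr rJ]; first by rewrite mul0r.
    have /subsetPn[x xK2 xK1] : ~~ (K (3 * r).+2 \subset K (3 * r).+1).
      by apply/negP => sub; apply: noi; exists r.
    pose Bx := [set y | y + (b0 - x) \in B].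
    have disj : K (3 * r)%N :&: Bx = finset.set0.
      apply/setP => y; rewrite finset.in_setI finset.in_set0 [y \in Bx]inE andbC; apply/negP => /andP[yB yK].
      case/negP: xK1.
      have -> : x = y + (b0 - (y + (b0 - x))).
        by rewrite opprD opprB [b0 + _]addrCA addNKr addrC subrK.
      by rewrite -addn1 KD // BK.
    have sub : K (3 * r)%N :|: Bx \subset K (3 * r.+1)%N.
      apply/fintype.subsetP => y; rewrite finset.in_setU => /orP[|].
        by apply: (fintype.subsetP (Ksub _ _ _)); lia.
      rewrite inE => yB; have -> : y = x + ((y + (b0 - x)) - b0).
        by rewrite [y + _]addrCA [b0 + _]addrC addrK addrCA subrr addr0.
      by have := KD _ _ _ _ xK2 (BK _ _ yB b0B); rewrite addn1 (_ : (3 * r).+3 = (3 * r.+1)%N) //; lia.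
    have := subset_leq_card sub; rewrite -(ler_nat R); apply: le_trans.
    rewrite cardsU disj cards0 subn0 natrD card_translate -natr1 mulrDl mul1r.
    by rewrite lerD ?IHr ?(ltW bigB)// ltnW.
  have := grow J (leqnn J); rewrite leNgt => /negP; apply.
  apply: le_lt_trans (_ : #|G|%:R < _); first by rewrite ler_nat max_card.
  by rewrite mulrA -[ltLHS]mul1r ltr_pM2r.
(* The shifts preserving the paused set are closed under addition and contain $B-b_0$, so they
   exhaust $G$; applying them to $0$ shows that the paused set is $G$. *)
pose H := [set h | [forall x in K (3 * i).+1, x + h \in K (3 * i).+1]].
have HE h : reflect (forall x, x \in K (3 * i).+1 -> x + h \in K (3 * i).+1) (h \in H).
  by rewrite inE; exact: forall_inP.
have Hall x : x \in H.
  apply: no_subgroup.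
  - by apply/HE => y yK; rewrite addr0.
  - move=> y z /HE Hy /HE Hz; apply/HE => w wK.
    by rewrite addrA Hz ?Hy.
  - apply: lt_le_trans bigB _; rewrite ler_nat -(card_translate B b0).
    apply: subset_leq_card; apply/fintype.subsetP => h; rewrite inE => hB.
    apply/HE => y yK; apply: (fintype.subsetP Kpause).
    by rewrite -(addrK b0 h) -addn1 KD ?BK.
move=> x; have := HE x (Hall x) 0 (K0 _); rewrite add0r inE => /le_trans; apply.
by rewrite ler_wpM2r // ler_nat; lia.
Qed.

(** The Dyson transform is iterated to a terminal pair $(A',B')$. If $|B'|\le\beta|G|$, [triples_ge]
    suffices. Otherwise $A'$ is nearly invariant under $B'-B'$, hence under every shift, which
    contradicts the average of [shift_defect]. *)
Lemma triples_lower_bound A B C (t J : nat) (sigma : R) :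
  1 < J%:R * beta -> (#|A| + #|B| <= #|G|)%N -> sigma * #|G|%:R <= #|A|%:R ->
  (t <= #|B|)%N -> (3 * J * t)%:R < sigma * beta ^+ 2 * #|G|%:R ->
  t%:R * (#|A| + #|B| + #|C|)%:R <=
    (triples A B C)%:R + t%:R * ((1 + beta) * #|G|%:R) :> R.
Proof.
move=> Jbeta AB sA tB tsmall.
have [A' [B' [cAB tB' AA' tr final]]] := dyson_terminal A B t tB.
have n0 : 0 < #|G|%:R :> R by rewrite ltr0n (cardD1 0).
have [smallB|bigB] := lerP #|B'|%:R (beta * #|G|%:R).
  have := triples_ge A' B' C t tB'; rewrite -(ler_nat R) natrD !natrM natrD => lo.
  have : (triples A' B' C)%:R <= (triples A B C)%:R :> R by rewrite ler_nat.
  have : t%:R * (#|A| + #|B| + #|C|)%:R =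
     t%:R * (#|A'|%:R + #|C|%:R) + t%:R * #|B'|%:R :> R.
    by rewrite -cAB !natrD; ring.
  have : t%:R * #|B'|%:R <= t%:R * (beta * #|G|%:R) :> R by rewrite ler_wpM2l.
  rewrite mulrDl mul1r mulrDr; lra.
exfalso.
pose Y := [set x | [forall b in B', b + x \in A']].
have YE y c : y \in Y -> c \in B' -> c + y \in A'.
  by rewrite inE => /forall_inP; apply.
(* Double counting of $B'\cap(A'-x)$ over all [x]: the total is $|A'||B'|$, and terminality leaves
   fewer than [t] elements for each [x] outside [Y]. *)
have cY : (#|A'| * #|B'| <= #|Y| * #|B'| + t * #|G|)%N.
  have <- : (\sum_x #|dyson_inter A' B' x| = #|A'| * #|B'|)%N.
    rewrite mulnC -sum_nat_const.
    rewrite (eq_bigr (fun x => \sum_b nat_of_bool ((b \in B') && ((b + x)%R \in A')))%N).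
      rewrite exchange_big /= [RHS]big_mkcond; apply: eq_bigr => b _ /=.
      case: ifP => bB; last by rewrite big1.
      rewrite -(card_translate A' b) -sum1_card [RHS]big_mkcond.
      by apply: eq_bigr => x _; rewrite inE addrC; case: ifP.
    move=> x _; rewrite -sum1_card [LHS]big_mkcond; apply: eq_bigr => b _.
    by rewrite inE; case: ifP.
  rewrite (bigID (mem Y)) /=; apply: leq_add.
    rewrite -sum_nat_const; apply: leq_sum => x _; apply: subset_leq_card.
    by apply/fintype.subsetP => b; rewrite inE => /andP[].
  apply: (@leq_trans (\sum_(x | x \notin Y) t)%N).
    apply: leq_sum => x xY; have [Bx|/ltnW //] := final x.
    by case/negP: xY; rewrite inE; apply/forall_inP.
  by rewrite sum_nat_const mulnC leq_mul2l max_card orbT.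
have defB b b' : b \in B' -> b' \in B' ->
    (shift_defect A' (b - b'))%:R <= t%:R / beta.
  move=> bB b'B; have := shift_defect_diff _ _ _ _ _ bB b'B YE.
  rewrite ler_pdivlMr // => dY.
  have : ((shift_defect A' (b - b'))%R * #|B'| <= t * #|G|)%N.
    rewrite -(leq_add2r (#|Y| * #|B'|)) -mulnDl.
    apply: leq_trans (leq_mul dY (leqnn _)) _.
    by rewrite [X in (_ <= X)%N]addnC.
  rewrite -(ler_nat R) !natrM => le1.
  have : (shift_defect A' (b - b'))%:R * (beta * #|G|%:R) <=
         (shift_defect A' (b - b'))%:R * #|B'|%:R by rewrite ler_wpM2l ?(ltW bigB).
  move=> /le_trans /(_ le1); rewrite mulrA ler_pM2r //.
have d0 : 0 <= t%:R / beta :> R by rewrite divr_ge0 ?(ltW beta_gt0).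
have spread := shift_defect_spread A' B' _ J d0 Jbeta bigB defB.
have := sum_shift_defect A'; move/(congr1 (fun k => k%:R : R)).
rewrite natr_sum => sumE.
have : \sum_x (shift_defect A' x)%:R <= #|G|%:R * ((3 * J)%:R * (t%:R / beta)) :> R.
  apply: (@le_trans _ _ (\sum_(x : G) (3 * J)%:R * (t%:R / beta))).
    by apply: ler_sum => x _.
  by rewrite sumr_const -[leLHS]mulr_natl lexx.
rewrite sumE natrM natrB ?max_card //.
have h1 : sigma * #|G|%:R <= #|A'|%:R.
  by apply: le_trans sA _; rewrite ler_nat.
have h2 : beta * #|G|%:R < #|G|%:R - #|A'|%:R.
  apply: lt_le_trans bigB _; rewrite lerBrDr -natrD ler_nat addnC cAB //.
move=> h3.
have : sigma * #|G|%:R * (beta * #|G|%:R) <= #|A'|%:R * (#|G|%:R - #|A'|%:R).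
  have b0 : 0 <= beta * #|G|%:R by rewrite mulr_ge0 ?(ltW beta_gt0) ?ltW.
  apply: (@le_trans _ _ (#|A'|%:R * (beta * #|G|%:R))).
    by rewrite ler_wpM2r.
  by rewrite ler_wpM2l // ltW.
move=> /le_trans /(_ h3); rewrite leNgt => /negP; apply.
have -> : sigma * #|G|%:R * (beta * #|G|%:R) =
    #|G|%:R / beta * (sigma * beta ^+ 2 * #|G|%:R) by field; rewrite gt_eqF.
have -> : #|G|%:R * ((3 * J)%:R * (t%:R / beta)) =
    #|G|%:R / beta * (3 * J * t)%:R by rewrite natrM; ring.
by rewrite ltr_pM2l // divr_gt0.
Qed.

End NoLargeSubgroup.
End PopularSums.

Lemma subset_of_card (T : finType) (A : {set T}) (k : nat) : (k <= #|A|)%N ->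
  exists2 B : {set T}, B \subset A & #|B| = k.
Proof.
move=> kA; exists [set x in take k (enum A)].
  by apply/fintype.subsetP => x; rewrite inE => /mem_take; rewrite mem_enum.
rewrite cardsE (card_uniqP _) ?take_uniq ?enum_uniq // size_take -cardE.
by case: ltngtP kA.
Qed.

(** * Popular sums in a group *)

Section PopularGroup.
Variable G : finZmodType.
Implicit Types A B : {set G}.

Definition sum_reps A B (c : G) : nat :=
  \sum_(p : G * G) [&& p.1 \in A, p.2 \in B & (p.1 + p.2)%R == c].

Lemma triples_reps A B (C : {set G}) :
  triples G A B C = (\sum_(c in C) sum_reps A B c)%N.
Proof.
rewrite exchange_big; apply: eq_bigr => -[a b] _ /=.
have [aA|_] := boolP (a \in A); have [bB|_] := boolP (b \in B);
  try by rewrite big1.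
have [abC|abC] := boolP (a + b \in C).
  rewrite (bigD1 (a + b)) //= eqxx big1 // => c /andP[_ /negPf].
  by rewrite eq_sym => ->.
by rewrite big1 // => c cC; case: eqP => // E; rewrite E cC in abC.
Qed.

Variables (R : realFieldType) (beta : R).
Hypothesis beta_gt0 : 0 < beta.
Hypothesis no_subgroup : forall H : {set G}, 0 \in H ->
  {in H &, forall x y, x + y \in H} ->
  beta * #|G|%:R < #|H|%:R -> forall x, x \in H.

(** [triples_lower_bound] is applied to the set [C] of unpopular elements. It receives at most
    $s|G|\le\beta t|G|$ pairs, so $|C|$ cannot be much larger than $|G|-|A|-|B|$ once the two sets
    are trimmed to fit. *)
Lemma card_popular A B (k t s J : nat) : 1 < J%:R * beta ->
  (k <= #|A|)%N -> (k <= #|B|)%N -> (2 * k <= #|G|)%N -> (0 < t <= k)%N ->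
  (3 * J * t)%:R < k%:R * beta ^+ 2 -> s%:R <= beta * t%:R ->
  (minn #|G| (#|A| + #|B|))%:R <=
    #|[set c | (s <= sum_reps A B c)%N]|%:R + 2 * beta * #|G|%:R.
Proof.
move=> Jbeta kA kB kG /andP[t0 tk] tsmall ssmall.
have n0 : 0 < #|G|%:R :> R by rewrite ltr0n (cardD1 0).
(* This size of [B'], with [A'] taking what room remains, makes the sizes add to $\min(|G|,|A|+|B|)$
   while both stay at least [k]. *)
pose cB := minn #|B| (maxn k (#|G| - #|A|)).
have [B' B'B cB'] : exists2 B' : {set G}, B' \subset B & #|B'| = cB.
  by apply: subset_of_card; rewrite /cB geq_minl.
have [A' A'A cA'] : exists2 A' : {set G}, A' \subset A & #|A'| = minn #|A| (#|G| - cB).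
  by apply: subset_of_card; rewrite geq_minl.
have AG : (#|A| <= #|G|)%N by exact: max_card.
have BG : (#|B| <= #|G|)%N by exact: max_card.
have sumAB : (#|A'| + #|B'| = minn #|G| (#|A| + #|B|))%N.
  by rewrite cA' cB' /cB; lia.
have kA' : (k <= #|A'|)%N by rewrite cA' /cB; lia.
have kB' : (k <= #|B'|)%N by rewrite cB' /cB; lia.
pose C := [set c | (sum_reps A B c < s)%N].
have cC : (#|C| + #|[set c | (s <= sum_reps A B c)%N]| = #|G|)%N.
  rewrite -(cardsC C); congr (_ + _)%N; apply: eq_card => c.
  by rewrite !inE -leqNgt.
have up : (triples G A' B' C <= s * #|G|)%N.
  apply: (@leq_trans (triples G A B C)).
    apply: leq_sum => -[a b] _ /=.
    have := fintype.subsetP A'A a; have := fintype.subsetP B'B b.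
    case: (a \in A'); case: (b \in B') => //= -> // -> //.
  rewrite triples_reps; apply: (@leq_trans (\sum_(c in C) s)%N).
    by apply: leq_sum => c; rewrite inE => /ltnW.
  by rewrite sum_nat_const mulnC leq_mul2l max_card orbT.
have := @triples_lower_bound G R beta beta_gt0 no_subgroup A' B' C t J
  (k%:R / #|G|%:R) Jbeta _ _ _ _.
rewrite sumAB geq_minl divfK ?gt_eqF // ler_nat kA' (leq_trans tk kB').
have -> : k%:R / #|G|%:R * beta ^+ 2 * #|G|%:R = k%:R * beta ^+ 2.
  by field; rewrite gt_eqF.
move=> /(_ erefl erefl erefl tsmall); rewrite -sumAB.
have upR : (triples G A' B' C)%:R <= beta * t%:R * #|G|%:R.
  apply: (@le_trans _ _ (s * #|G|)%:R); first by rewrite ler_nat.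
  by rewrite natrM ler_wpM2r // ltW.
move=> lo.
have : t%:R * (#|A'| + #|B'| + #|C|)%:R <= t%:R * ((1 + 2 * beta) * #|G|%:R).
  apply: le_trans lo _.
  have -> : t%:R * ((1 + 2 * beta) * #|G|%:R) =
    beta * t%:R * #|G|%:R + t%:R * ((1 + beta) * #|G|%:R) by ring.
  by rewrite lerD2r.
rewrite ler_pM2l ?ltr0n // -{2}cC !natrD -{1}cC natrD; lra.
Qed.

End PopularGroup.

(** The cofactor $n/h$ is below $1/\beta$; if it exceeded 1, a prime factor of it would divide [n]
    and be too small. *)
Lemma large_divisor (R : realFieldType) (beta : R) (h n : nat) : 0 < beta ->
  (forall p, prime p -> (p %| n)%N -> beta^-1 < p%:R) -> (0 < n)%N ->
  (h %| n)%N -> beta * n%:R < h%:R -> h = n.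
Proof.
move=> beta0 pbig n0 /dvdnP[d nE] bigh.
have [|d1|d0] := ltngtP d 1%N; last by rewrite nE d0 mul1n.
  by rewrite ltnS leqn0 => /eqP d0; rewrite nE d0 in n0.
have := pbig _ (pdiv_prime d1) _; rewrite {1}nE dvdn_mulr ?pdiv_dvd //.
move=> /(_ erefl) lt1.
have : beta^-1 < d%:R.
  by apply: lt_le_trans lt1 _; rewrite ler_nat pdiv_leq // ltnW.
rewrite -[ltLHS]mul1r ltr_pdivrMr // => lt2.
have h0 : 0 < h%:R :> R by rewrite ltr0n; case: h nE {bigh} => // nE; rewrite nE muln0 in n0.
move: bigh; rewrite nE natrM mulrA -[ltRHS]mul1r ltr_pM2r // mulrC.
by move=> /(lt_trans lt2); rewrite ltxx.
Qed.

(** In a finite group, closure under addition already gives a subgroup, and Lagrange reduces the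
    claim to [large_divisor]. *)
Lemma Zp_no_subgroup (R : realFieldType) (beta : R) (m : nat) :
  0 < beta -> (forall p, prime p -> (p %| m.+1)%N -> beta^-1 < p%:R) ->
  forall H : {set 'I_m.+1}, 0 \in H -> {in H &, forall x y, x + y \in H} ->
  beta * #|'I_m.+1|%:R < #|H|%:R -> forall x, x \in H.
Proof.
move=> beta0 pbig H H0 HD bigH.
have gH : group_set H by apply/group_setP; split.
pose K := Group gH : {group 'I_m.+1}.
have dvd : (#|H| %| m.+1)%N.
  by have := cardSg (finset.subsetT K); rewrite cardsT card_ord.
rewrite card_ord in bigH.
have E := large_divisor _ _ _ _ beta0 pbig (ltn0Sn m) dvd bigH.
have /eqP -> : H == [set: 'I_m.+1].
  by rewrite eqEcard finset.subsetT cardsT card_ord E leqnn.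
by move=> x; rewrite inE.
Qed.

(** * Popular sums of sets of integers *)

Definition natcount (P : pred nat) (n : nat) : nat := count P (iota 0 n).

Lemma natcount_sum (P : pred nat) n : natcount P n = (\sum_(i < n) P i)%N.
Proof.
by rewrite /natcount -sum1_count big_mkcond -[n in iota 0 n]subn0 big_mkord.
Qed.

Lemma natcount_card (P : pred nat) n : natcount P n = #|[set i : 'I_n | P i]|.
Proof.
rewrite natcount_sum -sum1_card [RHS]big_mkcond.
by apply: eq_bigr => i _; rewrite inE.
Qed.

Lemma natcount_le (P : pred nat) n : (natcount P n <= n)%N.
Proof. by rewrite -[leqRHS](size_iota 0) count_size. Qed.

Lemma natcount_inj (P Q : pred nat) n l (f : nat -> nat) :
  (forall i, (i < n)%N -> P i -> (f i < l)%N && Q (f i)) ->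
  (forall i j, (i < n)%N -> (j < n)%N -> P i -> P j -> f i = f j -> i = j) ->
  (natcount P n <= natcount Q l)%N.
Proof.
move=> fPQ finj; rewrite /natcount -!size_filter -(size_map f).
apply: uniq_leq_size.
  rewrite map_inj_in_uniq ?filter_uniq ?iota_uniq // => i j.
  by rewrite !mem_filter !mem_iota /= => /andP[Pi ?] /andP[Pj ?]; exact: finj.
move=> y /seq.mapP[i iP ->]; move: iP; rewrite mem_filter mem_iota /= => /andP[Pi i_n].
by rewrite mem_filter mem_iota /=; have /andP[-> ->] := fPQ i i_n Pi.
Qed.

Lemma natcount_sub (P Q : pred nat) n : (forall i, (i < n)%N -> P i -> Q i) ->
  (natcount P n <= natcount Q n)%N.
Proof. by move=> PQ; apply: (natcount_inj _ _ _ _ id) => // i i_n Pi; rewrite i_n PQ. Qed.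

Section Sumset.
Variables (A B : pred nat) (W : nat).

Definition reps (x : nat) : nat :=
  \sum_(a < W.+1) \sum_(b < W.+1) [&& A a, B b & a + b == x]%N.

Definition reps_mod (m q : nat) : nat :=
  \sum_(a < m) \sum_(b < m) [&& A a, B b & a + b == q %[mod m]]%N.

(** Residues are represented in $[0,m)$, so a sum congruent to $q$ is either $q$ or $q+m$. *)
Lemma reps_mod_le m q : (m <= W.+1)%N -> (q < m)%N ->
  (reps_mod m q <= reps q + reps (q + m))%N.
Proof.
move=> mW qm; rewrite /reps -big_split /=.
pose F a b := ([&& A a, B b & a + b == q] + [&& A a, B b & a + b == q + m])%N.
apply: (@leq_trans (\sum_(a < m) \sum_(b < m) F a b)).
  apply: leq_sum => a _; apply: leq_sum => b _.
  rewrite /F; case: (A a); case: (B b) => //=.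
  have := ltn_ord a; have := ltn_ord b; rewrite (modn_small qm) => bm am.
  have [abm|abm] := ltnP (a + b) m; first by rewrite modn_small //; lia.
  rewrite -(subnK abm) modnDr modn_small; lia.
have widen (f : nat -> nat) : (\sum_(a < m) f a <= \sum_(a < W.+1) f a)%N.
  by rewrite (big_ord_widen _ f mW) big_mkcond /=; apply: leq_sum => a _; case: ifP.
apply: leq_trans (widen (fun a => \sum_(b < m) F a b)%N) _.
apply: leq_sum => a _; rewrite -big_split; exact: (widen (F a)).
Qed.

Variable s : nat.
Definition popular (x : nat) : bool := (s <= reps x)%N.

(** A residue with $2s$ representations makes $q$ or $q+m$ popular; choosing the smaller one injects
    such residues into the popular [x] for which $x-m$ is not popular. The map $b\mapsto u+m+b$
    lands in the popular [x] for which $x-m$ is popular as well, so the two counts add. *)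
Lemma popular_count (u m X : nat) : (0 < s)%N -> (0 < m)%N -> (u + m <= W)%N ->
  (2 * W <= X)%N ->
  (natcount (fun q => (2 * s <= reps_mod m q)%N) m +
   natcount (fun b => [&& B b, popular (u + b)%N & popular (u + m + b)%N]) W.+1
   <= natcount popular X.+1)%N.
Proof.
move=> s0 m0 umW WX.
pose low x := popular x && ~~ ((m <= x)%N && popular (x - m)%N).
pose high x := popular x && ((m <= x)%N && popular (x - m)%N).
have -> : natcount popular X.+1 = (natcount low X.+1 + natcount high X.+1)%N.
  rewrite !natcount_sum -big_split /=; apply: eq_bigr => i _.
  by rewrite /low /high; case: (popular i) => //=; case: (_ && _).
apply: leq_add.
  apply: (natcount_inj _ _ _ _ (fun q => if popular q then q else (q + m)%N)).
    move=> q qm big; case: ifPn => pq.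
      rewrite /low pq [(m <= q)%N]leqNgt qm /= andbT; lia.
    rewrite /low addnK (negPf pq) andbF andbT /popular.
    have := reps_mod_le m q _ qm; move: pq; rewrite /popular; lia.
  by move=> i j im jm _ _; case: ifP; case: ifP; lia.
apply: (natcount_inj _ _ _ _ (fun b => (u + m + b)%N)); last by move=> *; lia.
move=> b bW /and3P[_ p1 p2]; rewrite /high p2 addnAC addnK p1 /=; lia.
Qed.

Definition missed (u : nat) : nat :=
  natcount (fun b => B b && ~~ popular (u + b)%N) W.+1.

(** Each pair counted on the left represents an unpopular integer in $[0,2W]$, and each such integer
    has fewer than [s] representations. *)
Lemma missed_sum : (0 < s)%N ->
  (\sum_(u < W.+1 | A u) missed u <= s * (2 * W).+1)%N.
Proof.
move=> s0.
apply: (@leq_trans (\sum_(x < (2 * W).+1) (~~ popular x) * reps x)%N); last first.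
  rewrite [leqRHS]mulnC -[X in (_ <= X * _)%N]card_ord -sum_nat_const.
  by apply: leq_sum => x _; rewrite /popular; case: leqP => //=; lia.
under [leqRHS]eq_bigr do rewrite /reps big_distrr /=.
rewrite exchange_big /= big_mkcond; apply: leq_sum => a _.
case: ifP => Aa //; rewrite /missed natcount_sum.
under [leqRHS]eq_bigr do rewrite big_distrr /=.
rewrite exchange_big /=; apply: leq_sum => b _.
have abW : (a + b < (2 * W).+1)%N by have := ltn_ord a; have := ltn_ord b; lia.
rewrite (bigD1 (Ordinal abW)) //= eqxx andbT; apply: leq_trans (leq_addr _ _).
by case: (B b); case: (popular _).
Qed.

(** Markov's inequality and [missed_sum] bound the number of bad vertices; each of them meets at
    most $2(W+1)$ ordered edges, so some edge avoids them all. *)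
Lemma good_pair (E : rel nat) (g : nat) : (0 < s)%N ->
  (s * (2 * W).+1 * (2 * W.+1) <
    g.+1 * \sum_(u < W.+1) \sum_(v < W.+1) [&& A u, A v & E u v])%N ->
  exists u v, [/\ (u <= W)%N && (v <= W)%N, A u && A v, E u v,
                  (missed u <= g)%N & (missed v <= g)%N].
Proof.
move=> s0 many; apply: contrapT => none.
pose bad u := A u && (g < missed u)%N.
have few : (g.+1 * natcount bad W.+1 <= s * (2 * W).+1)%N.
  apply: leq_trans (missed_sum s0); rewrite natcount_sum big_distrr /=.
  rewrite [leqRHS]big_mkcond; apply: leq_sum => u _; rewrite /bad.
  by case: (A u) => //=; case: leqP => //; rewrite ?muln1 ?muln0.
move: many; rewrite ltnNge => /negP; apply.
apply: (@leq_trans (g.+1 * natcount bad W.+1 * (2 * W.+1))%N); last first.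
  by rewrite leq_mul2r few orbT.
rewrite -mulnA leq_mul2l /=.
apply: (@leq_trans (\sum_(u < W.+1) \sum_(v < W.+1) (bad u + bad v))%N).
  apply: leq_sum => u _; apply: leq_sum => v _.
  case: (boolP [&& _, _ & _]) => // /and3P[Au Av Euv].
  rewrite /bad Au Av /=; have [//|mu] := boolP (g < missed u)%N.
  have [//|mv] := boolP (g < missed v)%N; rewrite -!leqNgt in mu mv.
  exfalso; apply: none; exists (u : nat), (v : nat).
  by rewrite Au Av -(ltnS u) -(ltnS v) !ltn_ord.
under eq_bigr do rewrite big_split /= sum_nat_const card_ord -natcount_sum.
rewrite big_split /= sum_nat_const card_ord -big_distrr /= -natcount_sum; lia.
Qed.

Lemma missed_compl (u v : nat) : (natcount B W.+1 <=
  natcount (fun b => [&& B b, popular (u + b)%N & popular (v + b)%N]) W.+1 +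
  missed u + missed v)%N.
Proof.
rewrite /missed !natcount_sum -!big_split /=; apply: leq_sum => b _.
by case: (B b) => //=; case: (popular _); case: (popular _).
Qed.

(** Inside $[0,X]$ the popular sums and $Z-C$ overlap by inclusion-exclusion, and each common point
    gives at least [s] solutions. *)
Lemma triple_count (C : pred nat) (Z X : nat) : (Z <= X)%N ->
  (s * (natcount popular X.+1 + natcount C Z.+1) <=
   \sum_(a < W.+1) \sum_(b < W.+1) \sum_(c < Z.+1)
     [&& A a, B b, C c & a + b + c == Z] + s * X.+1)%N.
Proof.
move=> ZX.
pose Cr x := (x <= Z)%N && C (Z - x)%N.
have cCr : (natcount C Z.+1 <= natcount Cr X.+1)%N.
  apply: (natcount_inj _ _ _ _ (fun c => (Z - c)%N)); last by move=> *; lia.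
  by move=> c cZ Cc; rewrite /Cr subKn // Cc; lia.
pose I x := popular x && Cr x.
have UI : (natcount popular X.+1 + natcount Cr X.+1 <= X.+1 + natcount I X.+1)%N.
  rewrite -[X in (_ <= X + _)%N]card_ord -sum1_card !natcount_sum -!big_split /=.
  by apply: leq_sum => x _; rewrite /I; case: (popular x); case: (Cr x).
suff : (s * natcount I X.+1 <= \sum_(a < W.+1) \sum_(b < W.+1) \sum_(c < Z.+1)
     [&& A a, B b, C c & a + b + c == Z])%N by nia.
have -> : natcount I X.+1 = (\sum_(c < Z.+1) I (Z - c))%N.
  apply/eqP; rewrite eqn_leq -(natcount_sum (fun c => I (Z - c)%N)).
  apply/andP; split.
    apply: (natcount_inj _ _ _ _ (fun x => (Z - x)%N)).
      by move=> x _ Ix; case/and3P: (Ix) => _ xZ _; rewrite subKn // Ix; lia.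
    by move=> x y _ _ /and3P[_ ? _] /and3P[_ ? _]; lia.
  apply: (natcount_inj _ _ _ _ (fun x => (Z - x)%N)); last by move=> *; lia.
  by move=> x xZ ->; lia.
under [leqRHS]eq_bigr do rewrite exchange_big /=.
rewrite exchange_big big_distrr /=; apply: leq_sum => c _.
have cZ : (c <= Z)%N by rewrite -ltnS.
rewrite /I /Cr leq_subr subKn //=; case Cc: (C c); last by rewrite andbF muln0.
rewrite andbT; case: (boolP (popular _)); last by rewrite muln0.
rewrite muln1 => /leq_trans; apply; apply: leq_sum => a _; apply: leq_sum => b _.
by case: (A a); case: (B b) => //=; lia.
Qed.

End Sumset.

Lemma sum_reps_ord (A B : pred nat) (m : nat) (q : 'I_m.+1) :
  sum_reps 'I_m.+1 [set i : 'I_m.+1 | A i] [set i : 'I_m.+1 | B i] q =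
  reps_mod A B m.+1 q.
Proof.
rewrite /sum_reps /reps_mod pair_bigA; apply: eq_bigr => -[a b] _ /=.
by rewrite !inE -val_eqE /= (modn_small (ltn_ord q)).
Qed.

Lemma natcount_window (P : pred nat) (m n : nat) : (m <= n)%N ->
  (natcount P n <= natcount P m + (n - m))%N.
Proof.
move=> mn; rewrite /natcount -{1}(subnKC mn) iotaD count_cat leq_add2l.
by rewrite -{2}(size_iota (0 + m) (n - m)) count_size.
Qed.

Lemma half_floor (R : realType) (x : R) : 1 <= x ->
  exists n : nat, [/\ (0 < n)%N, x / 2 <= n%:R, n%:R <= x & x < n.+1%:R].
Proof.
move=> x1; have x0 : 0 <= x by lra.
exists (Num.truncn x); have /andP[le1 lt1] := truncn_itv x0.
have n0 : (0 < Num.truncn x)%N by rewrite truncn_gt0.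
split => //; have n1 : 1 <= (Num.truncn x)%:R :> R by rewrite ler1n.
by rewrite -natr1 in lt1; lra.
Qed.

(** The relation [E] holds only for pairs nearly [W] apart whose difference has no prime factor up
    to $1/\beta$. An edge inside [A] with few missed sums serves as the pair $(u,v)$ for
    [popular_count], and [triple_count] concludes. *)
Lemma dense_sets (R : realType) (beta kappa : R) :
  0 < beta <= 1 / 50 -> 0 < kappa <= 1 ->
  exists2 c : R, 0 < c & exists W0 : R,
  forall (W Z : nat) (A B C : pred nat) (E : rel nat),
  W0 <= W%:R -> (Z <= (2 * W).+1)%N ->
  20 * beta * W%:R <= (natcount A W.+1)%:R ->
  20 * beta * W%:R <= (natcount B W.+1)%:R ->
  (forall u v, (v <= W)%N -> E u v -> [/\ (u <= v)%N, (1 - 4 * beta) * W%:R <= (v - u)%:R &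
     forall p, prime p -> (p %| v - u)%N -> beta^-1 < p%:R]) ->
  kappa * W%:R ^+ 2 <=
    (\sum_(u < W.+1) \sum_(v < W.+1) [&& A u, A v & E u v])%N%:R ->
  (2 + 20 * beta) * W%:R <= (minn W (natcount A W.+1 + natcount B W.+1) +
     natcount B W.+1 + natcount C Z.+1)%:R ->
  c * W%:R ^+ 2 <= (\sum_(a < W.+1) \sum_(b < W.+1) \sum_(c < Z.+1)
     [&& A a, B b, C c & a + b + c == Z])%N%:R.
Proof.
move=> /andP[b0 b50] /andP[k0 k1].
have [J [_ _ _ Jb]] : exists n : nat, [/\ (0 < n)%N, beta^-1 / 2 <= n%:R, n%:R <= beta^-1 & beta^-1 < n.+1%:R].
  by apply: half_floor; rewrite -[leLHS]invr1 lef_pV2 ?posrE //; lra.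
have Jbeta : 1 < J.+1%:R * beta.
  by rewrite -(@ltr_pM2r _ beta) // mulVf ?gt_eqF in Jb.
have J0 : 0 < J.+1%:R :> R by rewrite ltr0n.
(* With $t\le\theta W$ and $g\ge\beta W/2$ this gives $3(J+1)t\le\beta^3W/4<g\beta^2$, as
   [card_popular] requires. *)
pose theta := beta ^+ 3 / (12 * J.+1%:R).
have t0 : 0 < theta by rewrite divr_gt0 ?exprn_gt0 // mulr_gt0.
have b21 : beta ^+ 2 <= 1 by rewrite expr_le1 //; lra.
have t1 : theta <= 1.
  rewrite /theta ler_pdivrMr ?mulr_gt0 // mul1r exprS.
  have J1 : 1 <= J.+1%:R :> R by rewrite ler1n.
  have : beta * beta ^+ 2 <= 1 * 1 by apply: ler_pM; rewrite ?exprn_ge0 //; lra.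
  lra.
(* With $s\le\xi W$, [good_pair] needs $12\xi W^3<\beta\kappa W^3$, whence a denominator above 12;
   the factor $\beta\theta$ also ensures $2s\le\beta t$. *)
pose xi := beta * theta * kappa / 13.
have bt0 : 0 < beta * theta by rewrite mulr_gt0.
have x0 : 0 < xi by rewrite /xi !mulr_gt0.
exists (xi * beta / 2); first by rewrite !mulr_gt0.
exists (beta^-1 + theta^-1 + xi^-1 + 100 / beta).
move=> W Z A B C E W0 ZW cA cB Egap Emany dense.
have bi0 : 0 < beta^-1 by rewrite invr_gt0.
have ti0 : 0 < theta^-1 by rewrite invr_gt0.
have xi0 : 0 < xi^-1 by rewrite invr_gt0.
have large (z : R) : 0 < z -> z^-1 <= W%:R -> 1 <= z * W%:R.
  by move=> z0 zW; rewrite -ler_pdivrMl // mulr1.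
have bW : 100 <= beta * W%:R.
  have : 100 / beta <= W%:R by lra.
  by rewrite ler_pdivrMr // mulrC.
have [g [g0 g1 g2 g3]] : exists n : nat, [/\ (0 < n)%N, beta * W%:R / 2 <= n%:R,
    n%:R <= beta * W%:R & beta * W%:R < n.+1%:R].
  by apply: half_floor; lra.
have [t [tp tlo tup _]] : exists n : nat, [/\ (0 < n)%N, theta * W%:R / 2 <= n%:R,
    n%:R <= theta * W%:R & theta * W%:R < n.+1%:R].
  by apply: half_floor; apply: large => //; lra.
have [s [sp slo sup _]] : exists n : nat, [/\ (0 < n)%N, xi * W%:R / 2 <= n%:R,
    n%:R <= xi * W%:R & xi * W%:R < n.+1%:R].
  by apply: half_floor; apply: large => //; lra.
have Wpos : 0 < W%:R :> R.
  by rewrite -(pmulr_rgt0 _ b0); lra.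
have W1 : 100 <= W%:R :> R.
  by apply: le_trans bW _; rewrite -[leRHS]mul1r ler_wpM2r //; lra.
have [||u [v [/andP[uW vW] /andP[Au Av] Euv mu mv]]] :=
    good_pair A B W s E g.
- by [].
- rewrite -(ltr_nat R) !natrM.
  apply: (@lt_le_trans _ _ (beta * W%:R * (kappa * W%:R ^+ 2))); last first.
    apply: ler_pM => //; [lra| |exact: ltW].
    by rewrite mulr_ge0 // ?exprn_ge0 // ltW.
  have h1 : (2 * W).+1%:R <= 3 * W%:R :> R by rewrite -natr1 natrM; lra.
  have h2 : W.+1%:R <= 2 * W%:R :> R by rewrite -natr1; lra.
  apply: (@le_lt_trans _ _ (xi * W%:R * (3 * W%:R) * (2 * (2 * W%:R)))).
    apply: ler_pM; rewrite ?mulr_ge0 //; last by rewrite ler_pM2l.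
    by apply: ler_pM.
  rewrite /xi.
  have -> : beta * theta * kappa / 13 * W%:R * (3 * W%:R) * (2 * (2 * W%:R)) =
     (theta * (12 / 13)) * (beta * W%:R * (kappa * W%:R ^+ 2)) by field.
  rewrite -[ltRHS]mul1r ltr_pM2r; first by lra.
  by rewrite !mulr_gt0 ?exprn_gt0.
have [uv gap pbig] := Egap u v vW Euv.
have [m mE] : exists m, (v - u)%N = m.+1.
  have : 0 < (v - u)%:R :> R.
    by apply: lt_le_trans gap; rewrite mulr_gt0 //; lra.
  by rewrite ltr0n; case: (v - u)%N => // m _; exists m.
rewrite mE in gap pbig.
have mW : (u + m.+1 <= W)%N by rewrite -mE subnKC.
have vE : v = (u + m.+1)%N by rewrite -mE subnKC.
have mW' : (m.+1 <= W)%N := leq_trans (leq_addl _ _) mW.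
have mWR : m.+1%:R <= W%:R :> R by rewrite ler_nat.
pose A' := [set i : 'I_m.+1 | A i]; pose B' := [set i : 'I_m.+1 | B i].
have m_le : (m.+1 <= W.+1)%N := leqW mW'.
have wA := natcount_window A _ _ m_le; have wB := natcount_window B _ _ m_le.
have cA' : #|A'| = natcount A m.+1 by rewrite natcount_card.
have cB' : #|B'| = natcount B m.+1 by rewrite natcount_card.
(* Restricting [A] and [B] from $[0,W]$ to the residue window $[0,m]$ loses at most this many
   elements of each. *)
have loss : (W.+1 - m.+1)%:R <= 4 * beta * W%:R + 1.
  by rewrite natrB // -[W.+1%:R]natr1; lra.
have cA'R : (natcount A W.+1)%:R <= (natcount A m.+1)%:R + (4 * beta * W%:R + 1).
  apply: (@le_trans _ _ (natcount A m.+1 + (W.+1 - m.+1))%:R).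
    by rewrite ler_nat.
  by rewrite natrD lerD2l.
have cB'R : (natcount B W.+1)%:R <= (natcount B m.+1)%:R + (4 * beta * W%:R + 1).
  apply: (@le_trans _ _ (natcount B m.+1 + (W.+1 - m.+1))%:R).
    by rewrite ler_nat.
  by rewrite natrD lerD2l.
have b1W : beta * W%:R <= W%:R / 50 by have := ler_wpM2r (ltW Wpos) b50; lra.
have tg : theta * W%:R <= beta * W%:R / 4.
  have -> : beta * W%:R / 4 = beta / 4 * W%:R by ring.
  rewrite ler_pM2r // /theta ler_pdivrMr ?mulr_gt0 //.
  have -> : beta / 4 * (12 * J.+1%:R) = beta * (3 * J.+1%:R) by field.
  rewrite exprS ler_pM2l //.
  have J1 : 1 <= J.+1%:R :> R by rewrite ler1n.
  lra.
have := card_popular 'I_m.+1 R beta b0 (Zp_no_subgroup R beta m b0 pbig)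
  A' B' g t (2 * s) J.+1 Jbeta.
rewrite cA' cB' card_ord.
have Q1 : (g <= natcount A m.+1)%N by rewrite -(ler_nat R); lra.
have Q2 : (g <= natcount B m.+1)%N by rewrite -(ler_nat R); lra.
have Q3 : (2 * g <= m.+1)%N by rewrite -(ler_nat R) natrM; lra.
have Q4 : (0 < t <= g)%N by rewrite tp -(ler_nat R); lra.
have Q5 : (3 * J.+1 * t)%:R < g%:R * beta ^+ 2.
  apply: (@lt_le_trans _ _ (beta * W%:R / 2 * beta ^+ 2)); last first.
    by rewrite ler_wpM2r // exprn_ge0 // ltW.
  rewrite !natrM; apply: (@le_lt_trans _ _ (3 * J.+1%:R * (theta * W%:R))).
    by rewrite ler_pM2l // mulr_gt0.
  have -> : 3 * J.+1%:R * (theta * W%:R) = beta * W%:R / 4 * beta ^+ 2.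
    by rewrite /theta; field; rewrite gt_eqF.
  by rewrite ltr_pM2r ?exprn_gt0 //; lra.
have Q6 : (2 * s)%:R <= beta * t%:R.
  apply: (@le_trans _ _ (beta * (theta * W%:R / 2))); last by rewrite ler_pM2l.
  rewrite natrM; apply: (@le_trans _ _ (2 * (xi * W%:R))); first by rewrite ler_pM2l.
  rewrite /xi.
  have -> : 2 * (beta * theta * kappa / 13 * W%:R) =
     (4 * kappa / 13) * (beta * (theta * W%:R / 2)) by field.
  rewrite -[leRHS]mul1r ler_pM2r; first by lra.
  by rewrite !mulr_gt0.
move=> /(_ Q1 Q2 Q3 Q4 Q5 Q6).
have -> : #|[set c | (2 * s <= sum_reps 'I_m.+1 A' B' c)%N]| =
    natcount (fun q => (2 * s <= reps_mod A B m.+1 q)%N) m.+1.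
  by rewrite natcount_card; apply: eq_card => q; rewrite !inE sum_reps_ord.
set Q := natcount (fun q => (2 * s <= reps_mod A B m.+1 q)%N) m.+1 => pop.
pose D := natcount (fun b => [&& B b, popular A B W s (u + b)%N
                                    & popular A B W s (v + b)%N]) W.+1.
pose S := natcount (popular A B W s) (2 * W).+2.
have SQD : (Q + D <= S)%N.
  rewrite /D vE; exact: (popular_count A B W s u m.+1 (2 * W).+1 sp isT mW (leqnSn _)).
have BD : (natcount B W.+1 <= D + missed A B W s u + missed A B W s v)%N.
  exact: missed_compl.
have := triple_count A B W s C Z _ ZW; rewrite -/S.
set T := (\sum_(a < W.+1) _)%N.
rewrite -(ler_nat R) natrM (natrD _ S) (natrD _ T) (natrM _ s) => fin.
have minle : (minn W (natcount A W.+1 + natcount B W.+1))%:R <=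
    (minn m.+1 (natcount A m.+1 + natcount B m.+1))%:R + (8 * beta * W%:R + 2) :> R.
  have [sm|sm] := leqP m.+1 (natcount A m.+1 + natcount B m.+1).
    have : (minn W (natcount A W.+1 + natcount B W.+1))%:R <= W%:R :> R.
      by rewrite ler_nat geq_minl.
    lra.
  have : (minn W (natcount A W.+1 + natcount B W.+1))%:R <=
      (natcount A W.+1 + natcount B W.+1)%:R :> R by rewrite ler_nat geq_minr.
  rewrite (natrD _ (natcount A W.+1)) (natrD _ (natcount A m.+1)); lra.
have bm : beta * m.+1%:R <= beta * W%:R by rewrite ler_pM2l.
have SQD' : Q%:R + D%:R <= S%:R :> R by rewrite -natrD ler_nat.
have BD' : (natcount B W.+1)%:R <= D%:R + g%:R + g%:R :> R.
  by rewrite -!natrD ler_nat (leq_trans BD) // leq_add ?leq_add.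
rewrite (natrD _ (minn _ _ + _)) (natrD _ (minn _ _)) in dense.
have X2 : (2 * W).+2%:R = 2 * W%:R + 2 :> R by rewrite -[(2 * W).+2]addn2 natrD natrM.
rewrite X2 in fin.
(* Of the surplus $20\beta W$, the window costs at most $8\beta W+2$, unpopular residues $2\beta W$
   and missed sums $2g\le2\beta W$; since $\beta W\ge100$, more than $\beta W$ remains. *)
have key : beta * W%:R <= S%:R + (natcount C Z.+1)%:R - (2 * W%:R + 2).
  rewrite mulrDl -mulrA in dense; lra.
have : s%:R * (beta * W%:R) <= T%:R.
  apply: (@le_trans _ _ (s%:R * (S%:R + (natcount C Z.+1)%:R - (2 * W%:R + 2)))).
    by rewrite ler_wpM2l.
  by rewrite mulrBr; lra.
apply: le_trans.
have -> : xi * beta / 2 * W%:R ^+ 2 = (xi * W%:R / 2) * (beta * W%:R) by ring.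
by rewrite ler_wpM2r //; lra.
Qed.

(** * From bounded functions to sets *)

(** Pointwise, [b] is at most the indicator of its level set plus $\eta+\rho$. *)
Lemma natcount_threshold (R : realDomainType) (b : nat -> R) (eta rho : R) (n : nat) :
  0 <= rho -> 0 <= eta -> (forall k, 0 <= b k <= 1 + rho) ->
  \sum_(k < n) b k <= (natcount (fun k => eta <= b k) n)%:R + (eta + rho) * n%:R.
Proof.
move=> rho0 eta0 bP; rewrite natcount_sum natr_sum -[n in n%:R]card_ord -sum1_card.
rewrite natr_sum mulr_sumr -big_split /=; apply: ler_sum => k _.
have /andP[bk0 bk1] := bP k; rewrite /=; case: lerP => lt /=; lra.
Qed.

(** The level sets at height [eta] satisfy [dense_sets], and each triple in them weighs at least
    $\eta^3$. The third function lives on an interval about twice as long as the others, which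
    matches the factor $1/2$ in the density condition. The lengths [W] and [Z] allow for the
    spreading caused by smoothing. *)
Lemma dense_functions (R : realType) (delta kappa : R) :
  0 < delta < 1 -> 0 < kappa < 1 ->
  exists c rho : R, [/\ 0 < c, 0 < rho <= delta / 100 & exists M0 : nat,
  forall (M N L : nat) (b1 b2 b3 : nat -> R) (alpha1 alpha2 alpha3 : R) (E : rel nat),
  let W := (M + 2 * L)%N in let Z := (N + 3 * L)%N in
  (M0 <= M)%N -> (2 * M <= N <= (2 * M).+1)%N -> L%:R <= rho * M%:R ->
  [/\ forall k, 0 <= b1 k <= 1 + rho, forall k, 0 <= b2 k <= 1 + rho &
      forall k, 0 <= b3 k <= 1 + rho] ->
  [/\ \sum_(k < W.+1) b1 k = alpha1 * M%:R, \sum_(k < W.+1) b2 k = alpha2 * M%:R &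
      \sum_(k < Z.+1) b3 k = alpha3 * N%:R] ->
  [/\ delta <= alpha1, delta <= alpha2, delta <= alpha3 &
      1 + delta <= (Num.min 1 (alpha1 + alpha2) + alpha2) / 2 + alpha3] ->
  (forall u v, (v <= W)%N -> E u v ->
     [/\ (u <= v)%N, (1 - 4 * (delta / 50)) * W%:R <= (v - u)%:R &
      forall p, prime p -> (p %| v - u)%N -> (delta / 50)^-1 < p%:R]) ->
  kappa * M%:R ^+ 2 <= \sum_(u < W.+1) \sum_(v < W.+1) (E u v)%:R * (b1 u * b1 v) ->
  c * M%:R ^+ 2 <= \sum_(x < W.+1) \sum_(y < W.+1) \sum_(z < Z.+1 | (x + y + z == Z)%N)
     b1 x * b2 y * b3 z].
Proof.
move=> /andP[d0 d1] /andP[k0 k1].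
(* Serves both as level and as the excess [rho]; it must be small against [delta] for the densities
   and against [kappa] for the edge count. *)
pose eta := delta * kappa / 100.
have dk : delta * kappa <= delta by rewrite ler_piMr // ltW.
have kd : delta * kappa <= kappa by rewrite ler_piMl // ltW.
have dk0 : 0 < delta * kappa by rewrite mulr_gt0.
have eta0 : 0 < eta by rewrite /eta; lra.
have eta_d : eta <= delta / 100 by rewrite /eta; lra.
have eta_k : eta <= kappa / 100 by rewrite /eta; lra.
have [||c c0 [W0 dense]] := dense_sets R (delta / 50) (kappa / 32).
- by apply/andP; split; lra.
- by apply/andP; split; lra.
exists (eta ^+ 3 * c), eta; split; [by rewrite mulr_gt0 ?exprn_gt0| by rewrite eta0|].
exists (Num.truncn `|W0|).+4 => M N L b1 b2 b3 al1 al2 al3 E W Z M0 /andP[MN NM] Lsmall.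
move=> [b1P b2P b3P] [s1 s2 s3] [a1 a2 a3 cond] Egap Ebig.
have M4 : 4 <= M%:R :> R by rewrite ler_nat (leq_trans _ M0).
have W0M : W0 <= M%:R.
  apply: le_trans (ler_norm _) _; have := truncn_itv (normr_ge0 W0).
  move=> /andP[_ /ltW /le_trans]; apply; rewrite ler_nat; by do 3 apply: ltnW.
have WE : W%:R = M%:R + 2 * L%:R :> R by rewrite /W natrD natrM.
have ZE : Z%:R = N%:R + 3 * L%:R :> R by rewrite /Z natrD natrM.
have NE1 : 2 * M%:R <= N%:R :> R by rewrite -natrM ler_nat.
have NE2 : N%:R <= 2 * M%:R + 1 :> R by rewrite -natrM natr1 ler_nat.
have L0 : 0 <= L%:R :> R by [].
have etaM : eta * M%:R <= M%:R / 100.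
  by rewrite [leRHS]mulrC ler_wpM2r //; lra.
have W2 : W.+1%:R <= 2 * M%:R :> R by rewrite -natr1 WE; lra.
have Z4 : Z.+1%:R <= 4 * M%:R :> R by rewrite -natr1 ZE; lra.
pose A k := eta <= b1 k; pose B k := eta <= b2 k; pose C k := eta <= b3 k.
have eta02 : 0 <= eta + eta by lra.
have cA : al1 * M%:R <= (natcount A W.+1)%:R + 4 * (eta * M%:R).
  rewrite -s1; apply: le_trans (natcount_threshold _ _ _ _ _ (ltW eta0) (ltW eta0) b1P) _.
  by rewrite lerD2l; apply: le_trans (ler_wpM2l eta02 W2) _; lra.
have cB : al2 * M%:R <= (natcount B W.+1)%:R + 4 * (eta * M%:R).
  rewrite -s2; apply: le_trans (natcount_threshold _ _ _ _ _ (ltW eta0) (ltW eta0) b2P) _.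
  by rewrite lerD2l; apply: le_trans (ler_wpM2l eta02 W2) _; lra.
have cC : al3 * N%:R <= (natcount C Z.+1)%:R + 8 * (eta * M%:R).
  rewrite -s3; apply: le_trans (natcount_threshold _ _ _ _ _ (ltW eta0) (ltW eta0) b3P) _.
  by rewrite lerD2l; apply: le_trans (ler_wpM2l eta02 Z4) _; lra.
have M0R : 0 <= M%:R :> R by [].
have dM1 : delta * M%:R <= al1 * M%:R by rewrite ler_wpM2r.
have dM2 : delta * M%:R <= al2 * M%:R by rewrite ler_wpM2r.
have edM : eta * M%:R <= delta * M%:R / 100.
  by rewrite [leRHS]mulrAC ler_wpM2r.
have dMM : delta * M%:R <= M%:R by rewrite -[leRHS]mul1r ler_wpM2r // ltW.
have dL : delta * L%:R <= L%:R by rewrite -[leRHS]mul1r ler_wpM2r // ltW.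
have dW : delta * W%:R <= delta * M%:R + 2 * L%:R by rewrite WE mulrDr; lra.
have dense1 := dense W Z A B C E _ _ _ _ Egap _ _.
apply: (@le_trans _ _ (eta ^+ 3 * (c * W%:R ^+ 2))).
  rewrite -mulrA ler_pM2l ?exprn_gt0 // ler_pM2l // ler_sqr ?nnegrE //.
  by rewrite ler_nat leq_addr.
apply: (@le_trans _ _ (eta ^+ 3 * (\sum_(a < W.+1) \sum_(b < W.+1) \sum_(c < Z.+1)
     [&& A a, B b, C c & a + b + c == Z])%N%:R)); last first.
  rewrite natr_sum mulr_sumr; apply: ler_sum => x _.
  rewrite natr_sum mulr_sumr; apply: ler_sum => y _.
  rewrite natr_sum mulr_sumr [leRHS]big_mkcond; apply: ler_sum => z _.
  have /andP[p1 _] := b1P x; have /andP[p2 _] := b2P y; have /andP[p3 _] := b3P z.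
  case: ifP => [_|_]; last by rewrite !andbF mulr0.
  rewrite andbT; case: (boolP [&& _, _ & _]) => [/and3P[Ax By Cz]|_]; last first.
    by rewrite mulr0 !mulr_ge0.
  rewrite mulr1 exprSr expr2; apply: ler_pM => //; first by rewrite mulr_ge0 ?ltW.
  - exact: ltW.
  - by apply: ler_pM => //; exact: ltW.
rewrite ler_pM2l ?exprn_gt0 //; apply: dense1.
- by apply: le_trans W0M _; rewrite ler_nat leq_addr.
- by clear -NM; rewrite /Z /W; lia.
- rewrite (_ : 20 * (delta / 50) * W%:R = 2 / 5 * (delta * W%:R)); last by field.
  lra.
- rewrite (_ : 20 * (delta / 50) * W%:R = 2 / 5 * (delta * W%:R)); last by field.
  lra.
- rewrite natr_sum.
  under eq_bigr do rewrite natr_sum.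
  set EA := (X in _ <= X).
  (* As $b_1\le2$, an edge inside [A] contributes at most 4, and an edge with an end outside [A] at
     most $2\eta$. *)
  have : kappa * M%:R ^+ 2 <= 4 * EA + 2 * eta * W.+1%:R ^+ 2.
    apply: le_trans Ebig _.
    have -> : 2 * eta * W.+1%:R ^+ 2 = \sum_(u < W.+1) \sum_(v < W.+1) 2 * eta.
      rewrite sumr_const card_ord -mulr_natr sumr_const card_ord -mulr_natr; ring.
    rewrite /EA mulr_sumr -big_split; apply: ler_sum => u _.
    rewrite mulr_sumr -big_split; apply: ler_sum => v _ /=.
    have /andP[p1 q1] := b1P u; have /andP[p2 q2] := b1P v.
    case: (E u v); last first.
      by rewrite !andbF mul0r mulr0 add0r mulr_ge0 // ltW.
    have u2 : b1 u <= 2 by apply: le_trans q1 _; lra.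
    have v2 : b1 v <= 2 by apply: le_trans q2 _; lra.
    rewrite /A !andbT mul1r.
    case: (lerP eta (b1 u)) => [_|/ltW nu] /=; last first.
      by rewrite mulr0 add0r mulrC ler_pM.
    case: (lerP eta (b1 v)) => [_|/ltW nv] /=; last first.
      by rewrite mulr0 add0r ler_pM.
    by have := ler_pM p1 p2 u2 v2; lra.
  have W22 : W.+1%:R ^+ 2 <= 4 * M%:R ^+ 2 :> R.
    have -> : 4 * M%:R ^+ 2 = (2 * M%:R) ^+ 2 :> R by ring.
    by rewrite ler_sqr ?nnegrE // mulr_ge0.
  have := ler_wpM2l (ltW eta0) W22.
  have WW : W%:R ^+ 2 <= W.+1%:R ^+ 2 :> R by rewrite ler_sqr ?nnegrE // ler_nat.
  have := ler_wpM2l (ltW k0) (le_trans WW W22).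
  have MM : 0 <= M%:R ^+ 2 :> R by rewrite exprn_ge0.
  have := ler_wpM2r MM eta_k.
  have : 0 <= kappa * M%:R ^+ 2 by rewrite mulr_ge0 // ltW.
  lra.
- have -> : (2 + 20 * (delta / 50)) * W%:R = 2 * W%:R + 2 / 5 * (delta * W%:R) by field.
  rewrite (natrD _ (minn _ _ + _)) (natrD _ (minn _ _)).
  have a3N : al3 * (2 * M%:R) <= al3 * N%:R by rewrite ler_wpM2l //; lra.
  have condM := ler_wpM2r M0R cond.
  have minle : Num.min 1 (al1 + al2) * M%:R - 8 * (eta * M%:R) <=
      (minn W (natcount A W.+1 + natcount B W.+1))%:R.
    have [sm|sm] := leqP W (natcount A W.+1 + natcount B W.+1).
      have : Num.min 1 (al1 + al2) * M%:R <= 1 * M%:R by rewrite ler_wpM2r // ge_min lexx.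
      rewrite WE; lra.
    have : Num.min 1 (al1 + al2) * M%:R <= (al1 + al2) * M%:R by rewrite ler_wpM2r // ge_min lexx orbT.
    rewrite (natrD _ (natcount A W.+1)); lra.
  lra.
Qed.

(** * Fourier analysis on equally spaced points *)

Section Characters.
Local Open Scope complex_scope.
Context {R : realType}.
Implicit Types (x y t : R) (z : R[i]).

Lemma modulusM z1 z2 : modulus (z1 * z2) = modulus z1 * modulus z2.
Proof. exact: ComplexField.Normc.normcM. Qed.

Lemma modulusD z1 z2 : modulus (z1 + z2) <= modulus z1 + modulus z2.
Proof. exact: le_normcD. Qed.

Lemma modulus_ge0 z : 0 <= modulus z.
Proof. by case: z => a b; exact: sqrtr_ge0. Qed.

Lemma modulus0 : modulus (0 : R[i]) = 0.
Proof. exact: ComplexField.Normc.normc0. Qed.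

Lemma modulus_sum (I : Type) (r : seq I) (P : pred I) (F : I -> R[i]) :
  modulus (\sum_(i <- r | P i) F i) <= \sum_(i <- r | P i) modulus (F i).
Proof.
elim/big_ind2: _ => [|a b c d ab cd|//]; first by rewrite modulus0.
by apply: le_trans (modulusD _ _) _; exact: lerD.
Qed.

Lemma modulus_real x : modulus x%:C = `|x|.
Proof. by rewrite /modulus /= expr0n addr0 sqrtr_sqr. Qed.

Lemma Re_le_modulus z : `|complex.Re z| <= modulus z.
Proof.
case: z => a b; rewrite /modulus /= -sqrtr_sqr ler_wsqrtr //.
by rewrite lerDl sqr_ge0.
Qed.

Lemma modulus_sqr z : ((modulus z) ^+ 2)%:C = z * complex.conjc z.
Proof.
case: z => a b; rewrite /modulus /= sqr_sqrtr; last by rewrite addr_ge0 ?sqr_ge0.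
by apply/eqP; rewrite eq_complex /=; apply/andP; split; apply/eqP; ring.
Qed.

Lemma eD x y : e (x + y) = e x * e y.
Proof.
rewrite /e mulrDr cosD sinD; apply/eqP; rewrite eq_complex /= eqxx /=.
by rewrite addrC.
Qed.

Lemma e0 : e (0 : R) = 1.
Proof. by rewrite /e mulr0 cos0 sin0. Qed.

Lemma eN x : e (- x) = complex.conjc (e x).
Proof. by rewrite /e mulrN cosN sinN. Qed.

Lemma e_mulN x : e x * e (- x) = 1.
Proof. by rewrite -eD subrr e0. Qed.

Lemma modulus_e x : modulus (e x) = 1.
Proof. by rewrite /modulus /= cos2Dsin2 sqrtr1. Qed.

Lemma e_natM (n : nat) x : e (n%:R * x) = e x ^+ n.
Proof.
elim: n => [|n IHn]; first by rewrite mul0r e0 expr0.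
by rewrite -natr1 mulrDl mul1r eD IHn exprSr.
Qed.

Lemma e_nat (n : nat) : e (n%:R : R) = 1.
Proof.
rewrite -[n%:R]mulr1 e_natM (_ : e 1 = 1) ?expr1n //.
rewrite /e mulr1 mulr_natl cos2pi sin2pi //.
Qed.

(** By the double-angle formula, $\cos2\pi x=1$ would force $\sin\pi x=0$, but the sine is positive
    on $(0,\pi)$. *)
Lemma e_neq1 x : 0 < x < 1 -> e x != 1.
Proof.
move=> /andP[x0 x1]; apply/negP => /eqP/(congr1 (@complex.Re R)) /=.
have s0 : 0 < sin (pi * x).
  by apply: sin_gt0_pi; rewrite mulr_gt0 ?pi_gt0 //= -[ltRHS]mulr1 ltr_pM2l ?pi_gt0.
rewrite -mulrA mulr_natl cos_mulr2n => /eqP.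
rewrite subr_eq -mulr2n eqrMn2r // => /eqP c1.
have := cos2Dsin2 (pi * x); rewrite c1 -[RHS]addr0 => /addrI/eqP.
by rewrite sqrf_eq0 gt_eqF.
Qed.

Lemma e_neq1N x : -1 < x < 1 -> x != 0 -> e x != 1.
Proof.
move=> /andP[xm1 x1] xn0; have [x0|x0|x0] := ltgtP x 0.
- rewrite (_ : e x = e (x + 1)); last by rewrite eD (e_nat 1) mulr1.
  by apply: e_neq1; lra.
- by apply: e_neq1; rewrite x0.
- by rewrite x0 eqxx in xn0.
Qed.

Lemma geometric_root (M : nat) z : z ^+ M = 1 ->
  \sum_(r < M) z ^+ r = (if z == 1 then M%:R else 0).
Proof.
move=> zM; case: eqP => [->|/eqP z1].
  by under eq_bigr do rewrite expr1n; rewrite sumr_const card_ord.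
apply/eqP; have := subrX1 z M; rewrite zM subrr => /esym/eqP.
by rewrite mulf_eq0 subr_eq0 (negPf z1).
Qed.

(** Two uses are served: without a size restriction the unshifted sum is a nonnegative real, equal
    to [M] on the diagonal, which suffices for the one-sided bound in [smooth_le]; when $|a-b|<M$,
    orthogonality is exact for any shift [t]. *)
Lemma orthogonality (M a b : nat) t : (0 < M)%N ->
  exists2 d : R, 0 <= d & [/\
    \sum_(r < M) e (a%:R * (r%:R / M%:R)) * e (- (b%:R * (r%:R / M%:R))) = d%:C,
    (a = b -> d = M%:R) &
    ((a < b + M)%N -> (b < a + M)%N ->
     \sum_(r < M) e (a%:R * ((r%:R + t) / M%:R)) *
       e (- (b%:R * ((r%:R + t) / M%:R))) = (M%:R * (a == b)%:R)%:C)].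
Proof.
move=> M0; have Mn0 : M%:R != 0 :> R by rewrite pnatr_eq0 -lt0n.
pose x : R := (a%:R - b%:R) / M%:R.
have E s : \sum_(r < M) e (a%:R * ((r%:R + s) / M%:R)) *
       e (- (b%:R * ((r%:R + s) / M%:R))) = e (x * s) * \sum_(r < M) e x ^+ r.
  rewrite mulr_sumr; apply: eq_bigr => r _; rewrite -e_natM -!eD; congr e.
  by rewrite /x; ring.
have xM : e x ^+ M = 1.
  rewrite -e_natM /x mulrC divfK // eD e_nat mul1r.
  by have := e_mulN (b%:R : R); rewrite e_nat mul1r.
exists (if e x == 1 then M%:R else 0); first by case: ifP.
have Mreal n : n%:R = (n%:R)%:C :> R[i] by rewrite rmorph_nat.
split.
- have := E 0; rewrite mulr0 e0 mul1r geometric_root //.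
  under eq_bigr do rewrite !addr0.
  by move=> ->; case: ifP; rewrite ?Mreal.
- by move=> ab; rewrite /x ab subrr mul0r e0 eqxx.
move=> ab ba; rewrite E geometric_root //.
have [ab'|anb] := eqVneq a b.
  have -> : x = 0 by rewrite /x ab' subrr mul0r.
  by rewrite mul0r e0 eqxx mul1r mulr1 Mreal.
have xn0 : x != 0.
  by rewrite mulf_neq0 ?invr_neq0 // subr_eq0 eqr_nat.
have M0R : 0 < M%:R :> R by rewrite ltr0n.
rewrite (negPf (e_neq1N _ _ xn0)) ?mulr0 //.
move: ab ba; rewrite -!(ltr_nat R) !natrD /x => ab ba; apply/andP; split.
  by rewrite ltr_pdivlMr // mulN1r; lra.
by rewrite ltr_pdivrMr // mul1r; lra.
Qed.

End Characters.

(** * Smoothing *)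

Section Smoothing.
Local Open Scope complex_scope.
Context {R : realType}.
Implicit Types (f nu : nat -> R) (X : seq nat) (N L k : nat) (theta : R).

(* A smoothed copy of [f], translated by [L] so as to live on naturals:
   [f] is convolved with the uniform measures on [X] and on [L - X]. *)
Definition smooth N f X L k : R :=
  ((size X)%:R ^+ 2)^-1 * \sum_(1 <= n < N.+1) \sum_(x <- X) \sum_(y <- X)
    f n * (k == (n + x + (L - y))%N)%:R.

Definition seq_hat X theta : R[i] := \sum_(x <- X) e (x%:R * theta).

(** The Fourier multiplier of the smoothing, up to the phase due to the translation by [L]; see
    [fourier_smooth]. *)
Definition weight X theta : R :=
  ((size X)%:R ^+ 2)^-1 * (modulus (seq_hat X theta)) ^+ 2.

(** The morphism [h] lets one computation serve real test functions (mass, regularity) and complex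
    ones (Fourier transform). *)
Lemma smooth_sum (S : comNzRingType) (h : {rmorphism R -> S}) N f X L K (g : nat -> S) :
  (N + 2 * L < K)%N -> {in X, forall x, (x <= L)%N} ->
  \sum_(k < K) h (smooth N f X L k) * g k =
  h ((size X)%:R ^+ 2)^-1 * \sum_(1 <= n < N.+1) \sum_(x <- X) \sum_(y <- X)
    h (f n) * g (n + x + (L - y))%N.
Proof.
move=> NK XL.
under eq_bigr do rewrite /smooth rmorphM rmorph_sum -mulrA mulr_suml.
rewrite -mulr_sumr exchange_big /=; congr (_ * _).
rewrite big_nat [RHS]big_nat; apply: eq_bigr => n /andP[_ nN].
under eq_bigr do rewrite rmorph_sum mulr_suml.
rewrite exchange_big /=; apply: eq_big_seq => x xX.
under eq_bigr do rewrite rmorph_sum mulr_suml.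
rewrite exchange_big /=; apply: eq_big_seq => y yX.
have lt : (n + x + (L - y) < K)%N.
  by have := XL x xX; rewrite ltnS in nN; lia.
rewrite (bigD1 (Ordinal lt)) //= eqxx rmorphM rmorph1 mulr1 big1 ?addr0 //.
move=> k; rewrite -val_eqE /= => /negPf ->.
by rewrite rmorphM rmorph0 mulr0 mul0r.
Qed.

Lemma smooth_ge0 N f X L k : (forall n, (1 <= n <= N)%N -> 0 <= f n) ->
  0 <= smooth N f X L k.
Proof.
move=> f0; rewrite mulr_ge0 ?invr_ge0 ?sqr_ge0 // big_nat sumr_ge0 // => n nN.
apply: sumr_ge0 => x _; apply: sumr_ge0 => y _.
by rewrite mulr_ge0 // f0.
Qed.

Lemma seq_hat_conj X theta :
  complex.conjc (seq_hat X theta) = \sum_(y <- X) e (- (y%:R * theta)).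
Proof. by rewrite /seq_hat rmorph_sum; apply: eq_bigr => y _; rewrite eN. Qed.

Lemma modulus_seq_hat X theta : modulus (seq_hat X theta) <= (size X)%:R.
Proof.
apply: le_trans (modulus_sum _ _ _ _) _.
under eq_bigr do rewrite modulus_e.
by rewrite big_const_seq count_predT iter_addr_0.
Qed.

Lemma weight_ge0 X theta : 0 <= weight X theta.
Proof. by rewrite mulr_ge0 ?invr_ge0 ?sqr_ge0. Qed.

Lemma weight_le1 X theta : weight X theta <= 1.
Proof.
rewrite /weight mulrC; have [->|sX] := posnP (size X).
  by rewrite expr0n invr0 mulr0.
by rewrite ler_pdivrMr ?exprn_gt0 ?ltr0n // mul1r ler_sqr ?nnegrE
  ?modulus_ge0 ?modulus_seq_hat.
Qed.

Lemma fourier_smooth N f X L K theta :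
  (N + 2 * L < K)%N -> {in X, forall x, (x <= L)%N} ->
  \sum_(k < K) (smooth N f X L k)%:C * e (k%:R * theta) =
  e (L%:R * theta) * (weight X theta)%:C * fourier N f theta.
Proof.
move=> NK XL; rewrite (smooth_sum _ _ _ _ _ _ _ (fun k => e (k%:R * theta)) NK XL) /=.
rewrite /weight rmorphM /= modulus_sqr seq_hat_conj /seq_hat /fourier.
set c := (_^-1)%:C; set H := \sum_(x <- X) _; set Hc := \sum_(y <- X) _.
set F := \sum_(_ <= _ < _) _ * e _.
have -> : \sum_(1 <= n < N.+1) \sum_(x <- X) \sum_(y <- X)
    (f n)%:C * e ((n + x + (L - y))%:R * theta) = F * (H * Hc) * e (L%:R * theta).
  rewrite 2!mulr_suml; apply: eq_bigr => n _.
  rewrite /H /Hc big_distrlr mulr_sumr mulr_suml; apply: eq_bigr => x _ /=.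
  rewrite mulr_sumr mulr_suml; apply: eq_big_seq => y yX /=.
  rewrite !natrD natrB ?XL // !mulrDl !eD mulNr; ring.
ring.
Qed.

Lemma parseval X N : (0 < N)%N -> uniq X -> {in X, forall x, (x < N)%N} ->
  \sum_(r < N) (modulus (seq_hat X (r%:R / N%:R))) ^+ 2 = (N * size X)%:R :> R.
Proof.
move=> N0 uX XN; apply: (@complexI R); rewrite rmorph_sum.
under eq_bigr do rewrite /= modulus_sqr seq_hat_conj /seq_hat mulr_suml.
rewrite exchange_big /=.
transitivity (\sum_(x <- X) (N%:R : R[i])).
  apply: eq_big_seq => x xX.
  under eq_bigr do rewrite mulr_sumr.
  rewrite exchange_big /= (bigD1_seq x) //=.
  have orth y : y \in X -> \sum_(r < N) e (x%:R * (r%:R / N%:R)) *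
      e (- (y%:R * (r%:R / N%:R))) = (N%:R * (x == y)%:R)%:C :> R[i].
    move=> yX; have [d _ [_ _]] := orthogonality N x y (0 : R) N0.
    have := XN x xX; have := XN y yX => yN xN.
    move=> /(_ (ltn_addl _ xN) (ltn_addl _ yN)) <-.
    by apply: eq_bigr => r _; rewrite addr0.
  rewrite orth // eqxx mulr1 rmorph_nat big_seq_cond big1 ?addr0 // => y.
  move=> /andP[yX yx]; rewrite orth // eq_sym (negPf yx) mulr0.
  by [].
by rewrite big_const_seq count_predT iter_addr_0 natrM mulr_natr rmorphMn rmorph_nat.
Qed.

(** The majorant [nu] is smoothed on $\mathbb{Z}/N\mathbb{Z}$ by Fourier inversion. The zero
    frequency gives the main term, and Parseval bounds the others by [eta] times $N\cdot N|X|$.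
    Terms wrapping around modulo [N] are nonnegative and can only help. *)
Lemma smooth_le N f nu X L k eta : (0 < N)%N -> (0 < size X)%N -> uniq X ->
  {in X, forall x, (x <= L)%N} -> (L < N)%N ->
  (forall n, (1 <= n <= N)%N -> 0 <= f n <= nu n) -> pseudorandom N nu eta ->
  smooth N f X L k <= 1 + eta * N%:R / (size X)%:R.
Proof.
move=> N0 X0 uX XL LN fnu pr.
have N0R : 0 < N%:R :> R by rewrite ltr0n.
have X0R : 0 < (size X)%:R :> R by rewrite ltr0n.
have XN : {in X, forall x, (x < N)%N} by move=> x /XL /leq_ltn_trans; apply.
pose th (r : nat) : R := r%:R / N%:R.
pose S0 := \sum_(r < N) fourier N nu (th r) *
  ((modulus (seq_hat X (th r))) ^+ 2)%:C * e ((L%:R - k%:R) * th r).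
have upper : modulus S0 <= N%:R * (size X)%:R ^+ 2 + eta * N%:R * (N%:R * (size X)%:R).
  apply: le_trans (modulus_sum _ _ _ _) _.
  rewrite -[(N%:R * (size X)%:R)%R]natrM -(parseval _ _ N0 uX XN).
  apply: (@le_trans _ _ (\sum_(r < N) ((r == 0 :> nat)%:R * N%:R + eta * N%:R) *
     (modulus (seq_hat X (th r))) ^+ 2)).
    apply: ler_sum => r _; rewrite !modulusM modulus_e mulr1 modulus_real.
    rewrite ger0_norm ?sqr_ge0 // ler_wpM2r ?sqr_ge0 //.
    have := pr r (ltn_ord r); set z := fourier _ _ _; set w := (_ * _)%:C => prr.
    rewrite -[z](subrK w); apply: le_trans (modulusD _ _) _.
    rewrite addrC lerD // modulus_real ger0_norm // mulr_ge0.
  under eq_bigr do rewrite mulrDl.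
  rewrite big_split /= -mulr_sumr lerD2r.
  rewrite (bigD1 (Ordinal N0)) //= big1 ?addr0; last first.
    by move=> r; rewrite -val_eqE /= => /negPf ->; rewrite !mul0r.
  rewrite mul1r ler_pM2l // ler_sqr ?nnegrE ?modulus_ge0 //.
  exact: modulus_seq_hat.
have lower : exists2 s : R, S0 = s%:C & N%:R * (size X)%:R ^+ 2 * smooth N f X L k <= s.
  have D a b : exists d : R, [/\ 0 <= d, a = b -> d = N%:R &
     \sum_(r < N) e (a%:R * th r) * e (- (b%:R * th r)) = d%:C].
    by have [d d0 [E1 E2 _]] := orthogonality N a b (0 : R) N0; exists d.
  have {}D a := choice (D a).
  pose d a := projT1 (D a); have dP a b : [/\ 0 <= d a b, a = b -> d a b = N%:R &
     \sum_(r < N) e (a%:R * th r) * e (- (b%:R * th r)) = (d a b)%:C].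
    exact: (projT2 (D a) b).
  exists (\sum_(1 <= n < N.+1) \sum_(x <- X) \sum_(y <- X)
     nu n * d (n + x + L)%N (k + y)%N).
    rewrite /S0.
    under eq_bigr do rewrite modulus_sqr seq_hat_conj /seq_hat /fourier
      mulr_suml mulr_suml.
    rewrite exchange_big rmorph_sum; apply: eq_bigr => n _ /=.
    under eq_bigr do rewrite mulr_suml mulr_sumr mulr_suml.
    rewrite exchange_big rmorph_sum; apply: eq_bigr => x _ /=.
    under eq_bigr do rewrite mulr_sumr mulr_sumr mulr_suml.
    rewrite exchange_big rmorph_sum; apply: eq_bigr => y _ /=.
    have [_ _ dE] := dP (n + x + L)%N (k + y)%N.
    rewrite rmorphM /= -dE mulr_sumr; apply: eq_bigr => r _.
    rewrite -!mulrA -!eD; congr (_ * e _); rewrite !natrD; ring.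
  rewrite /smooth mulrA mulfK; last by rewrite expf_neq0 // gt_eqF.
  rewrite mulr_sumr big_nat [leRHS]big_nat; apply: ler_sum => n nN.
  rewrite mulr_sumr; apply: ler_sum => x _.
  rewrite mulr_sumr [leLHS]big_seq [leRHS]big_seq; apply: ler_sum => y yX.
  have [d0 dN _] := dP (n + x + L)%N (k + y)%N.
  have /andP[f0 f1] := fnu n nN.
  case: eqP => [kE|_]; last by rewrite !mulr0 mulr_ge0 // (le_trans f0).
  rewrite dN; first by rewrite mulr1 mulrC ler_wpM2r // ltW.
  by have := XL y yX; lia.
have [s S0E low] := lower.
have : N%:R * (size X)%:R ^+ 2 * smooth N f X L k <=
   N%:R * (size X)%:R ^+ 2 * (1 + eta * N%:R / (size X)%:R).
  apply: (le_trans low); apply: le_trans (ler_norm s) _.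
  rewrite -modulus_real -S0E; apply: le_trans upper _.
  rewrite le_eqVlt; apply/orP; left; apply/eqP; field.
  by rewrite gt_eqF.
by rewrite ler_pM2l // mulr_gt0 // exprn_gt0.
Qed.

(** The range condition confines $x+y+z-Z$ to $(-M,M)$, so [M] equally spaced points detect equality
    exactly, wherever the shift [t] puts them. *)
Lemma circle (r1 r2 r3 : seq nat) (g1 g2 g3 : nat -> R) (M Z : nat) t : (0 < M)%N ->
  {in r1 & r2, forall x y, {in r3, forall z,
    ((x + y + z < Z + M) && (Z < x + y + z + M))%N}} ->
  (M%:R * \sum_(x <- r1) \sum_(y <- r2) \sum_(z <- r3 | (x + y + z == Z)%N)
     g1 x * g2 y * g3 z)%:C =
  \sum_(r < M) (\sum_(x <- r1) (g1 x)%:C * e (x%:R * ((r%:R + t) / M%:R))) *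
    (\sum_(x <- r2) (g2 x)%:C * e (x%:R * ((r%:R + t) / M%:R))) *
    (\sum_(x <- r3) (g3 x)%:C * e (x%:R * ((r%:R + t) / M%:R))) *
    e (- (Z%:R * ((r%:R + t) / M%:R))).
Proof.
move=> M0 rng.
under [RHS]eq_bigr do rewrite !mulr_suml.
rewrite [RHS]exchange_big mulr_sumr rmorph_sum /=; apply: eq_big_seq => x xr.
under [RHS]eq_bigr do rewrite [X in X * _ * _]mulr_sumr !mulr_suml.
rewrite [RHS]exchange_big mulr_sumr rmorph_sum /=; apply: eq_big_seq => y yr.
under [RHS]eq_bigr do rewrite mulr_sumr !mulr_suml.
rewrite [RHS]exchange_big mulr_sumr rmorph_sum big_mkcond /=; apply: eq_big_seq => z zr.
have /andP[lt1 lt2] := rng x y xr yr z zr.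
have [d _ [_ _ orth]] := orthogonality M (x + y + z) Z t M0.
have {}orth := orth lt1 lt2.
transitivity ((g1 x * g2 y * g3 z)%:C * (M%:R * (x + y + z == Z)%N%:R)%:C).
  rewrite -rmorphM; case: eqP => _; last by rewrite !mulr0.
  by rewrite mulr1 mulrC.
rewrite -orth mulr_sumr; apply: eq_bigr => r _.
rewrite !rmorphM /= !natrD !mulrDl !eD; ring.
Qed.

End Smoothing.

(** * Discretizing the circle *)

Section Averaging.
Import numFieldNormedType.Exports.
Local Open Scope classical_set_scope.
Local Open Scope complex_scope.
Context {R : realType}.
Notation mu := (@lebesgue_measure R).

Lemma continuous_norm_powR (q : R) : 0 < q -> continuous ((fun y => `|y| `^ q) : R -> R).
Proof.
move=> q0 y; have [->|y0] := eqVneq y 0.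
  apply/cvgrPdist_lt => eps eps0; rewrite normr0 powR0 ?gt_eqF //.
  near=> z; rewrite sub0r normrN ger0_norm ?powR_ge0 //.
  have -> : eps = (eps `^ q^-1) `^ q.
    by rewrite -powRrM mulVf ?gt_eqF // powRr1 // ltW.
  rewrite gt0_ltr_powR ?nnegrE ?powR_ge0 //.
  near: z. apply: (@nbhs0_lt R R^o); exact: powR_gt0.
have cc : {for y, continuous ((fun z : R => z `^ q) \o ((fun y => `|y|) : R -> R))}; last exact: cc.
apply: continuous_comp.
  exact: (@norm_continuous _ R^o).
apply: differentiable_continuous; apply/derivable1_diffP.
by apply: derivable_powR; rewrite in_itv /= andbT normr_gt0.
Unshelve. all: by end_near. Qed.

Lemma continuous_mul (f g : R -> R) : continuous f -> continuous g ->
  continuous (fun x => f x * g x).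
Proof. by move=> cf cg x; exact: (continuousM (cf x) (cg x)). Qed.

Lemma continuous_add (f g : R -> R) : continuous f -> continuous g ->
  continuous (fun x => f x + g x).
Proof. by move=> cf cg x; exact: (continuousD (cf x) (cg x)). Qed.

Lemma continuous_bigsum (I : Type) (r : seq I) (F : I -> R -> R) :
  (forall i, continuous (F i)) -> continuous (fun x => \sum_(i <- r) F i x).
Proof.
move=> cF; elim: r => [|i r IHr] x.
  by under eq_fun do rewrite big_nil; exact: cst_continuous.
under eq_fun do rewrite big_cons.
by apply: continuous_add; [exact: cF|move=> y; exact: IHr].
Qed.

Lemma Re_sum (I : Type) (r : seq I) (F : I -> R[i]) :
  complex.Re (\sum_(i <- r) F i) = \sum_(i <- r) complex.Re (F i).
Proof. by elim/big_rec2: _ => // i a b _ <-; case: (F i) b => ? ? []. Qed.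

Lemma Im_sum (I : Type) (r : seq I) (F : I -> R[i]) :
  complex.Im (\sum_(i <- r) F i) = \sum_(i <- r) complex.Im (F i).
Proof. by elim/big_rec2: _ => // i a b _ <-; case: (F i) b => ? ? []. Qed.

Lemma continuous_modulus_fourier N f : continuous (fun x : R => modulus (fourier N f x)).
Proof.
pose c (n : nat) (x : R) := f n * cos (2 * pi * (n%:R * x)).
pose s (n : nat) (x : R) := f n * sin (2 * pi * (n%:R * x)).
have cE : (fun x => modulus (fourier N f x)) =
    Num.sqrt \o (fun x => (\sum_(1 <= n < N.+1) c n x) * (\sum_(1 <= n < N.+1) c n x) +
      (\sum_(1 <= n < N.+1) s n x) * (\sum_(1 <= n < N.+1) s n x)).
  apply/funext => x; rewrite /modulus /ComplexField.Normc.normc /= -!expr2.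
  have -> : \sum_(1 <= n < N.+1) c n x = complex.Re (fourier N f x).
    by rewrite Re_sum; apply: eq_bigr => n _; rewrite /= mul0r subr0.
  have -> : \sum_(1 <= n < N.+1) s n x = complex.Im (fourier N f x).
    by rewrite Im_sum; apply: eq_bigr => n _; rewrite /= mul0r addr0.
  by case: fourier.
rewrite cE => x; apply: continuous_comp; last exact: sqrt_continuous.
have lin n : continuous (fun x : R => 2 * pi * (n%:R * x)).
  apply: continuous_mul; first by move=> y; exact: cst_continuous.
  by apply: continuous_mul => y; [exact: cst_continuous|exact: cvg_id].
have cc n : continuous (c n).
  apply: continuous_mul => y; first exact: cst_continuous.
  by apply: continuous_comp; [exact: lin|exact: continuous_cos].
have cs n : continuous (s n).
  apply: continuous_mul => y; first exact: cst_continuous.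
  by apply: continuous_comp; [exact: lin|exact: continuous_sin].
by apply: continuous_add; apply: continuous_mul; exact: continuous_bigsum.
Qed.

(* The average over the cosets r/M + [0, 1/M] turns the integral into a sum over
   M equally spaced points. *)
Lemma equidistributed_average (g : R -> R) (M : nat) : (0 < M)%N -> continuous g ->
  exists t : R, \sum_(r < M) g ((r%:R + t) / M%:R) =
    M%:R * (\int[mu]_(x in `[0%R, 1%R]) g x)%R.
Proof.
move=> M0 cg; have M0R : 0 < M%:R :> R by rewrite ltr0n.
(* The primitive starts at $-1$ so that it is differentiable at 0 as well. *)
pose F (x : R) := (\int[mu]_(y in [set` `[(-1)%R, x]]) g y)%R.
have gint (a b : R) : mu.-integrable `[a, b] (EFin \o g).
  apply: continuous_compact_integrable; first exact: segment_compact.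
  exact: continuous_subspaceT.
have dF (x : R) : -1 < x -> is_derive x 1 F (g x).
  move=> x1; have [dFx Fx] := @continuous_FTC1_closed R g (-1) x (x + 1) (ltr_pwDr ltr01 (lexx _)) (gint _ _) x1 (cg x).
  by apply: DeriveDef => //; rewrite -derive1E.
(* $H(1)-H(0)$ telescopes to $F(1)-F(0)$, and the mean value theorem on $[0,1]$ supplies the
   shift. *)
pose H (t : R) := \sum_(r < M) F ((r%:R + t) / M%:R).
have dH (t : R) : -1 < t -> is_derive t 1 H (\sum_(r < M) g ((r%:R + t) / M%:R) / M%:R).
  move=> t1.
  have := @is_derive_sum _ _ _ M (fun (r : 'I_M) (t : R) => F ((r%:R + t) / M%:R)) t 1
    (fun r => g ((r%:R + t) / M%:R) / M%:R).
  have -> : \sum_(i < M) (fun t0 : R => F ((i%:R + t0) / M%:R)) = H.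
    by apply/funext => x; rewrite fct_sumE.
  apply => r.
  have lin : is_derive t 1 (fun t : R => (r%:R + t) / M%:R) (M%:R^-1).
    have -> : (fun t : R => (r%:R + t) / M%:R) = cst (r%:R / M%:R) + M%:R^-1 \*: id.
      by apply/funext => x; transitivity (r%:R / M%:R + M%:R^-1 * x) => //; rewrite mulrDl [M%:R^-1 * x]mulrC.
    by apply: is_derive_eq; rewrite add0r [_ *: _]mulr1.
  have : is_derive ((r%:R + t) / M%:R) 1 F (g ((r%:R + t) / M%:R)).
    apply: dF.
    rewrite ltr_pdivlMr // mulN1r.
    have r0 : 0 <= r%:R :> R by []. have M1 : 1 <= M%:R :> R by rewrite ler1n.
    by lra.
  by move=> dFr; exact: (@is_derive1_comp R F (fun t : R => (r%:R + t) / M%:R) t _ _ dFr lin).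
have cH : {within `[0%R, 1%R], continuous H}.
  apply: derivable_within_continuous => x; rewrite in_itv /= => /andP[x0 _].
  have dx : is_derive x 1 H (\sum_(r < M) g ((r%:R + x) / M%:R) / M%:R).
    by apply: dH; apply: lt_le_trans x0; rewrite oppr_lt0.
  exact: ex_derive.
have [|t _ tE] := @MVT_segment R H (fun t => \sum_(r < M) g ((r%:R + t) / M%:R) / M%:R) 0 1 ler01 _ cH.
  by move=> x; rewrite in_itv /= => /andP[x0 _]; apply: dH; lra.
exists t.
have {}tE : \sum_(r < M) g ((r%:R + t) / M%:R) / M%:R = F 1 - F 0.
  rewrite subr0 mulr1 in tE; rewrite -tE /H -sumrB.
  rewrite (eq_bigr (fun r : 'I_M => F (r.+1%:R / M%:R) - F (r%:R / M%:R))).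
    rewrite -(big_mkord xpredT (fun r => F (r.+1%:R / M%:R) - F (r%:R / M%:R))).
    by rewrite telescope_sumr // divff ?gt_eqF // mul0r.
  by move=> r _; rewrite natr1 addr0.
have -> : (\int[mu]_(x in `[0%R, 1%R]) g x)%R = F 1 - F 0.
  rewrite /F -(@Rintegral_itv_obnd_cbnd _ 0 (BRight 1)); last first.
    by apply: integrableS (gint 0 1) => //; exact: subset_itv_oc_cc.
  by rewrite -(@Rintegral_itvB _ g (BLeft (-1)) (BRight 1) 0) // bnd_simp; lra.
by rewrite -tE -mulr_suml mulrC divfK ?gt_eqF.
Qed.

End Averaging.

(** * A structured set of frequencies' common near-periods *)

Lemma pigeonhole (T : finType) (col : nat -> T) (l : nat) : (0 < l)%N ->
  exists c, (l <= size [seq j <- iota 0 l | col j == c] * #|T|)%N.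
Proof.
move=> l0; apply: contrapT => none.
have T0 : (0 < #|T|)%N by rewrite (cardD1 (col 0%N)).
have sumE : (\sum_(c : T) size [seq j <- iota 0 l | col j == c] = l)%N.
  under eq_bigr do rewrite size_filter -sum1_count big_mkcond /=.
  rewrite exchange_big /= -[RHS](size_iota 0) -sum1_size; apply: eq_bigr => j _.
  by rewrite -big_mkcond (big_pred1 (col j)) // => c; rewrite /= eq_sym.
have : (\sum_(c : T) size [seq j <- iota 0 l | col j == c] * #|T| <= \sum_(c : T) l.-1)%N.
  apply: leq_sum => c _; rewrite -ltnS prednK // ltnNge; apply/negP => le.
  by apply: none; exists c.
rewrite -big_distrl /= sumE sum_nat_const mulnC leq_pmul2l //.
by rewrite leqNgt ltn_predL l0.
Qed.

Section StructuredSet.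
Context {R : realType}.
Local Open Scope complex_scope.

Lemma cell_close (D : nat) (u v : R) : (0 < D)%N -> -1 <= u <= 1 -> -1 <= v <= 1 ->
  inord (Num.truncn (D%:R * (1 + u))) = inord (Num.truncn (D%:R * (1 + v))) :> 'I_(2 * D).+1 ->
  (u - v) ^+ 2 <= (D%:R ^+ 2)^-1.
Proof.
move=> D0 uP vP /(congr1 (@nat_of_ord _)).
have D0R : 0 < D%:R :> R by rewrite ltr0n.
have pos w : -1 <= w <= 1 -> 0 <= D%:R * (1 + w) :> R.
  by move=> /andP[? ?]; rewrite mulr_ge0 //; lra.
have small w : -1 <= w <= 1 -> (Num.truncn (D%:R * (1 + w : R)) < (2 * D).+1)%N.
  move=> wP; rewrite ltnS -(ler_nat R); have /andP[le _] := truncn_itv (pos w wP).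
  apply: le_trans le _; rewrite natrM mulrC ler_pM2r //; case/andP: wP; lra.
rewrite !inordK ?small // => E.
have := truncn_itv (pos u uP); have := truncn_itv (pos v vP); rewrite E.
move=> /andP[v1 v2] /andP[u1 u2]; rewrite -natr1 in u2 v2.
rewrite -[leRHS]div1r ler_pdivlMr ?exprn_gt0 // -exprMn -[leRHS](expr1n _ 2).
rewrite -[leRHS]real_normK ?num_real // -[leLHS]real_normK ?num_real //.
rewrite ler_sqr ?nnegrE ?normr_ge0 // normr1 ler_norml; apply/andP; split; lra.
Qed.

(** After rotation by the phase of one fixed element, every term of $\hat X$ has real part at least
    $1-\varepsilon$; then $(1-\varepsilon)^2\ge1-2\varepsilon$. *)
Lemma weight_ge (X : seq nat) (theta eps : R) : (0 < size X)%N -> 0 <= eps <= 1 ->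
  {in X &, forall x y, 1 - eps <= cos (2 * pi * (x%:R * theta)) * cos (2 * pi * (y%:R * theta)) +
    sin (2 * pi * (x%:R * theta)) * sin (2 * pi * (y%:R * theta))} ->
  1 - 2 * eps <= weight X theta.
Proof.
move=> X0 /andP[e0 e1] close.
have s0 : 0 < (size X)%:R :> R by rewrite ltr0n.
have [y yX] : exists y, y \in X.
  by case: X X0 {close s0} => // y X _; exists y; rewrite mem_head.
have low : (size X)%:R * (1 - eps) <= modulus (seq_hat X theta).
  have -> : modulus (seq_hat X theta) = modulus (seq_hat X theta * e (- (y%:R * theta))).
    by rewrite modulusM modulus_e mulr1.
  apply: le_trans (Re_le_modulus _); apply: le_trans (ler_norm _).
  rewrite /seq_hat mulr_suml.
  have -> : (size X)%:R * (1 - eps) = \sum_(x <- X) (1 - eps).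
    by rewrite big_const_seq count_predT iter_addr_0 mulr_natl.
  rewrite Re_sum big_seq [leRHS]big_seq; apply: ler_sum => x xX.
  apply: le_trans (close x y xX yX) _; rewrite /e /= mulrN cosN sinN.
  by rewrite mulrN opprK.
have e1' : 0 <= (size X)%:R * (1 - eps) by rewrite mulr_ge0 //; lra.
have {}low : ((size X)%:R * (1 - eps)) ^+ 2 <= modulus (seq_hat X theta) ^+ 2.
  by rewrite ler_sqr ?nnegrE ?modulus_ge0.
rewrite /weight -(@ler_pM2l _ ((size X)%:R ^+ 2)) ?exprn_gt0 // mulVKf ?expf_neq0 ?gt_eqF //.
apply: le_trans low; rewrite exprMn ler_pM2l ?exprn_gt0 //.
have := sqr_ge0 eps; rewrite sqrrB; lra.
Qed.

(** Simultaneous recurrence by pigeonhole: [j] is coloured by the cells, of side $1/D$, containing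
    the points $e(Pj\theta_i)$, and [X] is [P] times a popular colour class. Squared chords at most
    $2/D^2$ mean cosines of angle differences at least $1-1/D^2$. *)
Lemma structured_set (m D P l : nat) (theta : 'I_m -> R) :
  (1 < D)%N -> (0 < P)%N -> (0 < l)%N ->
  exists X : seq nat, [/\ uniq X, {in X, forall x, (x <= P * l)%N && (P %| x)%N},
    (l <= size X * (((2 * D).+1 * (2 * D).+1) ^ m))%N &
    forall i, 1 - 2 / D%:R ^+ 2 <= weight X (theta i)].
Proof.
move=> D1 P0 l0; have D0 : (0 < D)%N by apply: ltnW.
pose cell (u : R) : 'I_(2 * D).+1 := inord (Num.truncn (D%:R * (1 + u))).
pose ang (i : 'I_m) (j : nat) : R := 2 * pi * ((P * j)%:R * theta i).
pose col j := [ffun i => (cell (cos (ang i j)), cell (sin (ang i j)))].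
have [c cl] := pigeonhole _ col _ l0.
set Y := [seq j <- _ | _] in cl; exists (map (muln P) Y); rewrite size_map.
have Y0 : (0 < size Y)%N by case: (size Y) cl => //; rewrite mul0n leqNgt l0.
split.
- rewrite map_inj_uniq ?filter_uniq ?iota_uniq // => i j /eqP.
  by rewrite eqn_pmul2l // => /eqP.
- move=> x /seq.mapP[j]; rewrite mem_filter mem_iota /= => /andP[_ jl] ->.
  by rewrite dvdn_mulr // leq_mul2l ltnW ?orbT.
- by rewrite card_ffun card_prod !card_ord in cl.
move=> i; have D0R : 0 < D%:R ^+ 2 :> R by rewrite exprn_gt0 // ltr0n.
apply: weight_ge; rewrite ?size_map //.
  rewrite invr_ge0 (ltW D0R) /= invf_le1 // -[leLHS](expr1n _ 2).
  by rewrite ler_sqr ?nnegrE // ler1n.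
move=> x y /seq.mapP[a aY ->] /seq.mapP[b bY ->].
rewrite !mem_filter in aY bY; case/andP: aY => /eqP ca _; case/andP: bY => /eqP cb _.
have [E1 E2] : cell (cos (ang i a)) = cell (cos (ang i b)) /\
               cell (sin (ang i a)) = cell (sin (ang i b)).
  by have := congr1 (fun h : {ffun _} => h i) (etrans ca (esym cb)); rewrite !ffunE => -[].
have range (w : R) : -1 <= cos w <= 1 /\ -1 <= sin w <= 1.
  by rewrite cos_le1 cos_geN1 sin_le1 sin_geN1.
have c1 := cell_close _ _ _ D0 (range (ang i a)).1 (range (ang i b)).1 E1.
have c2 := cell_close _ _ _ D0 (range (ang i a)).2 (range (ang i b)).2 E2.
have ta := cos2Dsin2 (ang i a); have tb := cos2Dsin2 (ang i b).
rewrite -/(ang i a) -/(ang i b).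
move: c1 c2 ta tb; rewrite !expr2; set ca' := cos _; set cb' := cos _; set sa := sin _; set sb := sin _.
move=> c1 c2 ta tb; lra.
Qed.

End StructuredSet.

(** * Transference *)

Section Transference.
Import numFieldNormedType.Exports.
Context {R : realType}.
Local Open Scope complex_scope.

(** Both counts are [circle] sums over the same points. The three translations by [L] cancel against
    the target $Z+3L$, so the integrands differ exactly by the factor [weight] cubed. *)
Lemma smooth_triple_error (N1 N2 N3 L Z M : nat) (X : seq nat) (a1 a2 a3 : nat -> R) (t : R) :
  (0 < M)%N -> {in X, forall x, (x <= L)%N} ->
  (Z < M)%N -> (N1 + N2 + N3 < Z + M)%N ->
  (Z + 3 * L < M)%N -> (N1 + 2 * L + (N2 + 2 * L) + (N3 + 3 * L) < Z + 3 * L + M)%N ->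
  M%:R * (\sum_(x < (N1 + 2 * L).+1) \sum_(y < (N2 + 2 * L).+1)
     \sum_(z < (N3 + 3 * L).+1 | (x + y + z == Z + 3 * L)%N)
       smooth N1 a1 X L x * smooth N2 a2 X L y * smooth N3 a3 X L z -
   \sum_(1 <= x < N1.+1) \sum_(1 <= y < N2.+1) \sum_(1 <= z < N3.+1 | (x + y + z == Z)%N)
       a1 x * a2 y * a3 z) <=
  \sum_(r < M) (1 - weight X ((r%:R + t) / M%:R) ^+ 3) *
    (modulus (fourier N1 a1 ((r%:R + t) / M%:R)) *
     modulus (fourier N2 a2 ((r%:R + t) / M%:R)) *
     modulus (fourier N3 a3 ((r%:R + t) / M%:R))).
Proof.
move=> M0 XL ZM NZM ZLM NLM.
pose th (r : 'I_M) : R := (r%:R + t) / M%:R.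
set Tb := \sum_(x < _) _; set Ta := \sum_(_ <= x < _) _.
have EA : (M%:R * Ta)%:C = \sum_(r < M) fourier N1 a1 (th r) * fourier N2 a2 (th r) *
    fourier N3 a3 (th r) * e (- (Z%:R * th r)).
  apply: circle => // x y; rewrite !mem_index_iota => xr yr z; rewrite mem_index_iota => zr.
  lia.
have EB : (M%:R * Tb)%:C = \sum_(r < M) ((weight X (th r)) ^+ 3)%:C *
   (fourier N1 a1 (th r) * fourier N2 a2 (th r) * fourier N3 a3 (th r) * e (- (Z%:R * th r))).
  have -> : Tb = \sum_(0 <= x < (N1 + 2 * L).+1) \sum_(0 <= y < (N2 + 2 * L).+1)
     \sum_(0 <= z < (N3 + 3 * L).+1 | (x + y + z == Z + 3 * L)%N)
       smooth N1 a1 X L x * smooth N2 a2 X L y * smooth N3 a3 X L z.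
    rewrite big_mkord; apply: eq_bigr => x _; rewrite big_mkord; apply: eq_bigr => y _.
    by rewrite big_mkord.
  rewrite (circle _ _ _ _ _ _ M (Z + 3 * L) t M0); last first.
    by move=> x y; rewrite !mem_index_iota => xr yr z; rewrite mem_index_iota => zr; lia.
  apply: eq_bigr => r _; rewrite -/(th r) !big_mkord !fourier_smooth //; try lia.
  have -> : e (- ((Z + 3 * L)%:R * th r)) =
      e (- (Z%:R * th r)) * e (- (L%:R * th r)) ^+ 3.
    by rewrite -e_natM -eD natrD natrM; congr e; ring.
  have E1 : e (L%:R * th r) ^+ 3 * e (- (L%:R * th r)) ^+ 3 = 1.
    by rewrite -exprMn e_mulN expr1n.
  rewrite rmorphXn /= -[RHS]mul1r -E1; ring.
apply: le_trans (ler_norm _) _.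
rewrite mulrBr -modulus_real.
have -> : (M%:R * Tb - M%:R * Ta)%:C = (M%:R * Tb)%:C - (M%:R * Ta)%:C by rewrite rmorphB.
rewrite EA EB -sumrB.
apply: le_trans (modulus_sum _ _ _ _) _; apply: ler_sum => r _.
rewrite -/(th r) -[X in modulus (_ - X)]mul1r -mulrBl modulusM.
rewrite (_ : _%:C - 1 = (weight X (th r) ^+ 3 - 1)%:C); last by rewrite rmorphB rmorph1.
rewrite modulus_real distrC ger0_norm; last first.
  by rewrite subr_ge0 exprn_ile1 ?weight_ge0 ?weight_le1.
by rewrite !modulusM modulus_e mulr1.
Qed.

(** Split off $y_1^{3-q}\le B^{3-q}$; what remains, $y_1^{q-2}y_2y_3$, is at most the [q]-th power
    of the maximum. Only $y_1$ needs to be small for a gain. *)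
Lemma triple_powR (q B y1 y2 y3 : R) : 2 < q < 3 -> 0 <= y1 <= B -> 0 <= y2 -> 0 <= y3 ->
  y1 * y2 * y3 <= B `^ (3 - q) * (y1 `^ q + y2 `^ q + y3 `^ q).
Proof.
move=> /andP[q2 q3] /andP[y10 y1B] y20 y30.
have p1 := powR_ge0 y1 q; have p2 := powR_ge0 y2 q; have p3 := powR_ge0 y3 q.
have [y1z|y1n] := eqVneq y1 0.
  by rewrite y1z !mul0r mulr_ge0 ?powR_ge0 // !addr_ge0 ?powR_ge0.
have y1p : 0 < y1 by rewrite lt0r y1n.
have [Y [Y0 [Y1 Y2 Y3] Yq]] : exists Y : R, [/\ 0 < Y, [/\ y1 <= Y, y2 <= Y & y3 <= Y] &
    Y `^ q <= y1 `^ q + y2 `^ q + y3 `^ q].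
  exists (Num.max y1 (Num.max y2 y3)); split.
  - by rewrite lt_max y1p.
  - by rewrite !le_max !lexx !orbT.
  case: (leP y2 y3) => _; [case: (leP y1 y3) => _|case: (leP y1 y2) => _]; lra.
have -> : y1 * y2 * y3 = y1 `^ (3 - q) * (y1 `^ (q - 2) * y2 * y3).
  rewrite !mulrA -powRD; last by rewrite y1n implybT.
  by rewrite (_ : 3 - q + (q - 2) = 1); [rewrite powRr1|ring].
apply: ler_pM; rewrite ?mulr_ge0 ?powR_ge0 //.
  by apply: ge0_ler_powR; rewrite ?nnegrE //; lra.
apply: le_trans Yq.
have -> : Y `^ q = Y `^ (q - 2) * Y * Y.
  rewrite -mulrA -expr2 -powR_mulrn ?ltW // -powRD; last by apply/implyP => _; rewrite gt_eqF.
  by congr (_ `^ _); ring.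
apply: ler_pM; rewrite ?mulr_ge0 ?powR_ge0 //.
apply: ler_pM; rewrite ?powR_ge0 //.
by apply: ge0_ler_powR; rewrite ?nnegrE //; lra.
Qed.

Lemma extension_integral (N : nat) (f : nat -> R) (q K : R) : 0 < q -> 0 < K ->
  extension_estimate N f q K ->
  (\int[lebesgue_measure]_(theta in `[0%R, 1%R]%classic) modulus (fourier N f theta) `^ q)%R
     <= K `^ q * N%:R `^ (q - 1).
Proof.
move=> q0 K0; rewrite /extension_estimate /fourier_norm.
set I := (\int[_]_(_ in _) _)%R => ext.
have I0 : 0 <= I by apply: Rintegral_ge0 => x _; exact: powR_ge0.
have -> : I = (I `^ (1 / q)) `^ q.
  by rewrite -powRrM mul1r mulVf ?gt_eqF // powRr1.
apply: (@le_trans _ _ ((K * N%:R `^ (1 - 1 / q)) `^ q)).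
  by apply: ge0_ler_powR; rewrite ?nnegrE ?mulr_ge0 ?powR_ge0 ?(ltW q0) ?(ltW K0).
rewrite powRM ?powR_ge0 ?(ltW K0) // -powRrM.
by rewrite (_ : (1 - 1 / q) * q = q - 1) //; field; rewrite gt_eqF.
Qed.

(** [equidistributed_average] is applied to the sum of the three integrands, so one shift serves
    all; 6 is three functions times the factor 2 of the $2N$ points. *)
Lemma good_shift (N1 N2 N3 N : nat) (a1 a2 a3 : nat -> R) (q K : R) : (0 < N)%N ->
  (N1 <= N)%N -> (N2 <= N)%N -> (N3 <= N)%N -> 1 < q -> 0 < K ->
  extension_estimate N1 a1 q K -> extension_estimate N2 a2 q K ->
  extension_estimate N3 a3 q K ->
  exists t : R, \sum_(r < 2 * N) (modulus (fourier N1 a1 ((r%:R + t) / (2 * N)%:R)) `^ q +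
     modulus (fourier N2 a2 ((r%:R + t) / (2 * N)%:R)) `^ q +
     modulus (fourier N3 a3 ((r%:R + t) / (2 * N)%:R)) `^ q) <=
    6 * K `^ q * N%:R `^ q.
Proof.
move=> N0 le1 le2 le3 q1 K0 ext1 ext2 ext3; have q0 : 0 < q by lra.
pose h N f : R -> R := fun x => modulus (@fourier R N f x) `^ q.
have ch M f : continuous (h M f).
  have -> : h M f = (fun y : R => `|y| `^ q) \o (fun x => modulus (fourier M f x)).
    by apply/funext => x; rewrite /h /= ger0_norm // modulus_ge0.
  move=> x; apply: continuous_comp; first exact: continuous_modulus_fourier.
  exact: continuous_norm_powR.
have cint (g : R -> R) : continuous g ->
    lebesgue_measure.-integrable `[0%R, 1%R]%classic (EFin \o g).
  move=> cg; apply: continuous_compact_integrable; first exact: segment_compact.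
  exact: continuous_subspaceT.
have cg : continuous (fun x => h N1 a1 x + h N2 a2 x + h N3 a3 x).
  by apply: continuous_add; [apply: continuous_add|]; exact: ch.
have [t tE] := equidistributed_average _ (2 * N) (ltn_mul (ltnSn 1) N0) cg.
exists t; rewrite /h in tE; rewrite {}tE.
have bound M f : (M <= N)%N -> extension_estimate M f q K ->
    (\int[lebesgue_measure]_(x in `[0%R, 1%R]%classic) h M f x)%R <= K `^ q * N%:R `^ (q - 1).
  move=> leM ext; apply: le_trans (extension_integral _ _ _ _ q0 K0 ext) _.
  rewrite ler_wpM2l ?powR_ge0 //; apply: ge0_ler_powR; rewrite ?nnegrE ?ler_nat //; lra.
rewrite !RintegralD //; try exact/cint/ch; last first.
  by apply: cint; apply: continuous_add; exact: ch.
have := bound _ _ le1 ext1; have := bound _ _ le2 ext2; have := bound _ _ le3 ext3.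
rewrite /h; set I1 := Rintegral _ _ _; set I2 := Rintegral _ _ _; set I3 := Rintegral _ _ _.
move=> b3 b2 b1.
have N0R : 0 < N%:R :> R by rewrite ltr0n.
have -> : N%:R `^ q = N%:R * N%:R `^ (q - 1) :> R.
  rewrite -[X in X * _]powRr1 ?ltW // -powRD; last by apply/implyP => _; rewrite gt_eqF.
  by congr (_ `^ _); ring.
apply: (@le_trans _ _ ((2 * N)%:R * (3 * (K `^ q * N%:R `^ (q - 1))))).
  by rewrite ler_wpM2l //; lra.
by rewrite natrM; lra.
Qed.

End Transference.

(** * Choice of the smoothing set, mass and regularity after smoothing, conclusion *)

Section Assembly.
Context {R : realType}.
Local Open Scope complex_scope.

Lemma modulus_fourier_le N (f : nat -> R) theta :
  (forall n, (1 <= n <= N)%N -> 0 <= f n) ->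
  modulus (fourier N f theta) <= \sum_(1 <= n < N.+1) f n.
Proof.
move=> f0; apply: le_trans (modulus_sum _ _ _ _) _.
rewrite big_nat [leRHS]big_nat; apply: ler_sum => n nN.
by rewrite modulusM modulus_e mulr1 modulus_real ger0_norm ?f0.
Qed.

Lemma pseudorandom_sum N (nu : nat -> R) eta : (0 < N)%N -> pseudorandom N nu eta ->
  \sum_(1 <= n < N.+1) nu n <= (1 + eta) * N%:R.
Proof.
move=> N0 /(_ 0%N N0); rewrite mul0r.
set s := \sum_(_ <= _ < _) _.
have -> : fourier N nu 0 = s%:C.
  rewrite /fourier rmorph_sum; apply: eq_bigr => n _.
  by rewrite mulr0 e0 mulr1.
have -> : s%:C - ((0%N == 0%N)%:R * N%:R)%:C = (s - N%:R)%:C.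
  by rewrite eqxx mul1r rmorphB.
rewrite modulus_real => le1.
have := le_trans (ler_norm _) le1; lra.
Qed.

(** On the large spectrum of $a_1$, of size bounded independently of [N], [structured_set] brings
    the weight close to 1; elsewhere $\hat a_1$ is small and [triple_powR] gains. The shift [t] is
    fixed before [X], because the spectrum depends on it. *)
Lemma spectral_smoothing (q K gamma : R) : 2 < q < 3 -> 0 < K -> 0 < gamma ->
  exists2 B : nat, (0 < B)%N & forall (N1 N2 N3 N P l : nat) (a1 a2 a3 : nat -> R),
  (0 < N)%N -> (N1 <= N)%N -> (N2 <= N)%N -> (N3 <= N)%N -> (0 < P)%N -> (0 < l)%N ->
  extension_estimate N1 a1 q K -> extension_estimate N2 a2 q K ->
  extension_estimate N3 a3 q K ->
  (forall theta, modulus (fourier N1 a1 theta) <= 2 * N%:R) ->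
  exists (X : seq nat) (t : R),
  [/\ uniq X, {in X, forall x, (x <= P * l)%N && (P %| x)%N}, (l <= size X * B)%N &
   \sum_(r < 2 * N) (1 - weight X ((r%:R + t) / (2 * N)%:R) ^+ 3) *
    (modulus (fourier N1 a1 ((r%:R + t) / (2 * N)%:R)) *
     modulus (fourier N2 a2 ((r%:R + t) / (2 * N)%:R)) *
     modulus (fourier N3 a3 ((r%:R + t) / (2 * N)%:R))) <= 6 * gamma * K `^ q * N%:R ^+ 3].
Proof.
move=> qP K0 g0; have /andP[q2 q3] := qP.
(* Chosen so that off the large spectrum the gain $\varepsilon^{3-q}$ from [triple_powR] is exactly
   [gamma]. *)
pose eps := gamma `^ (3 - q)^-1.
have eps0 : 0 < eps by exact: powR_gt0.
have epsq : eps `^ (3 - q) = gamma.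
  by rewrite -powRrM mulVf ?powRr1 ?(ltW g0) // gt_eqF //; lra.
have eq0 : 0 < eps `^ q by exact: powR_gt0.
have Kq0 : 0 < K `^ q by exact: powR_gt0.
pose m := (Num.truncn (6 * K `^ q / eps `^ q)).+1.
(* On the large spectrum $1-w^3\le3(1-w)\le6/D^2$, and $|\hat a_1|\le2N$ costs a further
   $2^{3-q}\le2$; hence the requirement $12/D^2\le\gamma$. *)
pose D := (Num.truncn (12 / gamma)).+2.
have mP : 6 * K `^ q / eps `^ q < m%:R.
  have n0 : 0 <= 6 * K `^ q / eps `^ q by rewrite divr_ge0 ?mulr_ge0 ?ltW.
  by have /andP[] := truncn_itv n0.
have DP : 12 / D%:R ^+ 2 <= gamma.
  have n0 : 0 <= 12 / gamma by rewrite divr_ge0 ?ltW.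
  have /andP[_ lt] := truncn_itv n0.
  have D0 : 0 < D%:R :> R by rewrite ltr0n.
  rewrite ler_pdivrMr ?exprn_gt0 // -ler_pdivrMl // mulrC.
  apply: (@le_trans _ _ D%:R).
    by apply: ltW; apply: lt_trans lt _; rewrite ltr_nat.
  by rewrite expr2 ler_peMr ?(ltW D0) // ler1n.
exists (((2 * D).+1 * (2 * D).+1) ^ m)%N; first by rewrite expn_gt0 muln_gt0.
move=> N1 N2 N3 N P l a1 a2 a3 N0 le1 le2 le3 P0 l0 ext1 ext2 ext3 y1le.
have N0R : 0 < N%:R :> R by rewrite ltr0n.
have q1 : 1 < q by lra.
have [t tle] := good_shift N1 N2 N3 N a1 a2 a3 q K N0 le1 le2 le3 q1 K0 ext1 ext2 ext3.
pose th (r : 'I_(2 * N)) : R := (r%:R + t) / (2 * N)%:R.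
pose y1 r := modulus (fourier N1 a1 (th r)).
pose y2 r := modulus (fourier N2 a2 (th r)).
pose y3 r := modulus (fourier N3 a3 (th r)).
have {}tle : \sum_r (y1 r `^ q + y2 r `^ q + y3 r `^ q) <= 6 * K `^ q * N%:R `^ q by [].
pose Sp := [set r | eps * N%:R < y1 r].
have pos r : 0 <= y1 r `^ q + y2 r `^ q + y3 r `^ q by rewrite !addr_ge0 ?powR_ge0.
have cSp : (#|Sp| <= m)%N.
  have : (eps * N%:R) `^ q *+ #|Sp| <= 6 * K `^ q * N%:R `^ q.
    apply: le_trans tle; rewrite -sumr_const [leRHS](bigID (mem Sp)) /=.
    rewrite -[leLHS]addr0 lerD ?sumr_ge0 //; apply: ler_sum => r; rewrite inE => yr.
    apply: (@le_trans _ _ (y1 r `^ q)); last by rewrite -addrA lerDl addr_ge0 ?powR_ge0.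
    apply: ge0_ler_powR; rewrite ?nnegrE ?modulus_ge0 ?mulr_ge0 ?(ltW eps0) ?(ltW yr) //; lra.
  rewrite powRM ?(ltW eps0) // -mulr_natr mulrAC ler_pM2r ?powR_gt0 // => le.
  rewrite -(ler_nat R); apply: ltW; apply: le_lt_trans mP.
  by rewrite ler_pdivlMr // mulrC.
have [X [uX XP Xl Xw]] := structured_set #|Sp| D P l (fun i => th (enum_val i))
  isT P0 l0.
exists X, t; split => //.
  by apply: leq_trans Xl _; rewrite leq_mul2l leq_exp2l // cSp orbT.
have step r : (1 - weight X (th r) ^+ 3) * (y1 r * y2 r * y3 r) <=
    gamma * N%:R `^ (3 - q) * (y1 r `^ q + y2 r `^ q + y3 r `^ q).
  have w0 := weight_ge0 X (th r); have w1 := weight_le1 X (th r).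
  have y10 : 0 <= y1 r := modulus_ge0 _.
  have y20 : 0 <= y2 r := modulus_ge0 _.
  have y30 : 0 <= y3 r := modulus_ge0 _.
  have w3 : 0 <= 1 - weight X (th r) ^+ 3 by rewrite subr_ge0 exprn_ile1.
  have [rS|rS] := boolP (r \in Sp).
    have wr : 1 - 2 / D%:R ^+ 2 <= weight X (th r).
      by have := Xw (enum_rank_in rS r); rewrite enum_rankK_in.
    have up : y1 r * y2 r * y3 r <=
        (2 * N%:R) `^ (3 - q) * (y1 r `^ q + y2 r `^ q + y3 r `^ q).
      by apply: triple_powR => //; rewrite y10 y1le.
    have le3w : 1 - weight X (th r) ^+ 3 <= 6 / D%:R ^+ 2.
      move: (weight X (th r)) w0 w1 wr => w w0 w1 wr.
      have -> : 1 - w ^+ 3 = (1 - w) * (1 + w + w * w) by ring.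
      have ww : w * w <= 1 * 1 by apply: ler_pM.
      have h : (1 - w) * (1 + w + w * w) <= (1 - w) * 3.
        by clear -w1 ww; apply: ler_wpM2l; lra.
      by clear -h wr; lra.
    apply: (@le_trans _ _ (6 / D%:R ^+ 2 * ((2 * N%:R) `^ (3 - q) * (y1 r `^ q + y2 r `^ q + y3 r `^ q)))).
      by apply: ler_pM; rewrite ?mulr_ge0.
    rewrite mulrA ler_wpM2r // powRM // mulrA ler_wpM2r ?powR_ge0 //.
    apply: le_trans DP.
    have -> : 12 / D%:R ^+ 2 = 6 / D%:R ^+ 2 * 2 :> R by rewrite mulrAC -natrM.
    rewrite ler_wpM2l ?divr_ge0 ?exprn_ge0 //.
    have h2 : (2 : R) `^ (3 - q) <= 2 `^ 1 by clear -q2; apply: ler_powR; lra.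
    by rewrite powRr1 in h2.
  have yr : y1 r <= eps * N%:R by rewrite inE -leNgt in rS.
  have up : y1 r * y2 r * y3 r <=
      (eps * N%:R) `^ (3 - q) * (y1 r `^ q + y2 r `^ q + y3 r `^ q).
    by apply: triple_powR => //; rewrite y10 yr.
  rewrite powRM ?(ltW eps0) // epsq in up; apply: le_trans up.
  rewrite -[leRHS]mul1r ler_wpM2r ?mulr_ge0 // gerBl exprn_ge0 //.
apply: (@le_trans _ _ (\sum_r gamma * N%:R `^ (3 - q) * (y1 r `^ q + y2 r `^ q + y3 r `^ q))).
  by apply: ler_sum => r _; exact: step.
rewrite -mulr_sumr.
have NE : N%:R ^+ 3 = N%:R `^ (3 - q) * N%:R `^ q :> R.
  rewrite -powRD; last by apply/implyP => _; rewrite gt_eqF.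
  by rewrite subrK powR_mulrn // ltW.
rewrite NE.
have -> : 6 * gamma * K `^ q * (N%:R `^ (3 - q) * N%:R `^ q) =
  gamma * N%:R `^ (3 - q) * (6 * K `^ q * N%:R `^ q) by ring.
by rewrite ler_wpM2l // mulr_ge0 ?powR_ge0 // ltW.
Qed.

Lemma smooth_average N (F : nat -> R) (X : seq nat) : (0 < size X)%N ->
  ((size X)%:R ^+ 2)^-1 * \sum_(1 <= n < N.+1) \sum_(x <- X) \sum_(y <- X) F n =
  \sum_(1 <= n < N.+1) F n.
Proof.
move=> X0; have s0 : (size X)%:R != 0 :> R by rewrite pnatr_eq0 -lt0n.
have cst (c : R) : \sum_(x <- X) c = (size X)%:R * c.
  by rewrite big_const_seq count_predT iter_addr_0 mulr_natl.
rewrite mulr_sumr; apply: eq_bigr => n _.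
by rewrite !cst [_ * (_ * F n)]mulrA -expr2 mulrA mulVf ?mul1r ?expf_neq0.
Qed.

Lemma smooth_mass N (f : nat -> R) X L K : (0 < size X)%N -> (N + 2 * L < K)%N ->
  {in X, forall x, (x <= L)%N} ->
  \sum_(k < K) smooth N f X L k = \sum_(1 <= n < N.+1) f n.
Proof.
move=> X0 NK XL; have := smooth_sum R idfun N f X L K (fun=> 1) NK XL.
under eq_bigr do rewrite mulr1.
move=> ->; rewrite -(smooth_average N f X X0); congr (_ * _).
by apply: eq_bigr => n _; apply: eq_bigr => x _; apply: eq_bigr => y _; rewrite mulr1.
Qed.

Lemma dvdn_primorial (y : R) (p : nat) : prime p -> p%:R <= y -> (p %| primorial y)%N.
Proof.
move=> pp py; have y0 : 0 <= y by apply: le_trans py.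
have pt : (p < (Num.truncn y).+1)%N.
  have /andP[_ lt] := truncn_itv y0.
  by rewrite -(ltr_nat R); exact: le_lt_trans lt.
rewrite /primorial (big_rem p) /=; first by rewrite pp dvdn_mulr.
by rewrite mem_index_iota.
Qed.

Lemma primorial_gt0 (y : R) : (0 < primorial y)%N.
Proof. by apply: prodn_cond_gt0 => p; exact: prime_gt0. Qed.

Definition regular_edge (beta : R) (W : nat) : rel nat := fun u v =>
  [&& (u <= v)%N, (1 - 4 * beta) * W%:R <= (v - u)%:R &
      coprime (v - u) (primorial beta^-1)].

(** Smoothing moves each endpoint forward by at most $2L\le\beta N$ and, up to the common
    translation [L], by a multiple of the primorial. So the difference keeps its residue modulo the
    primorial, and the gap shrinks only to $(1-4\beta)W$. *)
Lemma smooth_regular N (f : nat -> R) X L (beta kappa : R) : (0 < size X)%N ->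
  {in X, forall x, (x <= L)%N && (primorial beta^-1 %| x)%N} ->
  (forall n, (1 <= n <= N)%N -> 0 <= f n) ->
  0 < beta <= 1 / 50 -> 2 * L%:R <= beta * N%:R -> regular N f beta kappa ->
  kappa * N%:R ^+ 2 <= \sum_(u < (N + 2 * L).+1) \sum_(v < (N + 2 * L).+1)
    (regular_edge beta (N + 2 * L) u v)%:R * (smooth N f X L u * smooth N f X L v).
Proof.
move=> X0 XP f0 /andP[b0 b1] Lb reg; set W := (N + 2 * L)%N; set P := primorial _ in XP.
have XL : {in X, forall x, (x <= L)%N} by move=> x /XP/andP[].
pose E := regular_edge beta W.
pose ends u v := [&& u%:R <= beta * N%:R, (1 - beta) * N%:R <= v%:R
        & gcdz (v%:Z - u%:Z) P%:Z == 1].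
have nearE n n' x y x' y' : x \in X -> y \in X -> x' \in X -> y' \in X ->
    ends n n' -> E (n + x + (L - y))%N (n' + x' + (L - y'))%N.
  move=> xX yX x'X y'X /and3P[nb nb' gcd1].
  have /andP[xL /dvdnP[kx xE]] := XP x xX; have /andP[yL /dvdnP[ky yE]] := XP y yX.
  have /andP[xL' /dvdnP[kx' xE']] := XP x' x'X; have /andP[yL' /dvdnP[ky' yE']] := XP y' y'X.
  have bN : beta * N%:R <= 1 / 50 * N%:R by rewrite ler_wpM2r.
  have uR : (n + x + (L - y))%:R <= beta * N%:R + 2 * L%:R :> R.
    have : (x + (L - y))%:R <= (L + L)%:R :> R by rewrite ler_nat leq_add // leq_subr.
    rewrite -addnA [(n + _)%:R]natrD natrD; lra.
  have vR : (1 - beta) * N%:R <= (n' + x' + (L - y'))%:R :> R.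
    by apply: le_trans nb' _; rewrite ler_nat -addnA leq_addr.
  have bL : 0 <= beta * L%:R by rewrite mulr_ge0 // ltW.
  have N0 : 0 <= N%:R :> R by [].
  have uv : (n + x + (L - y) <= n' + x' + (L - y'))%N.
    rewrite -(ler_nat R); apply: le_trans uR _; apply: le_trans vR; lra.
  apply/and3P; split => //.
    rewrite natrB // /W natrD natrM; lra.
  rewrite -/P /coprime -dvdn1; set d := gcdn _ _.
  have dP : (d %| P)%N by rewrite dvdn_gcdr.
  have duv : (d %| (n' + x' + (L - y')) - (n + x + (L - y)))%N by rewrite dvdn_gcdl.
  have -> : (1 = `|gcdz (n'%:Z - n%:Z) P%:Z|)%N by rewrite (eqP gcd1).
  rewrite -[(d %| _)%N]/(d%:Z %| gcdz (n'%:Z - n%:Z) P%:Z)%Z dvdz_gcd.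
  have dPz : (d%:Z %| P%:Z)%Z by [].
  rewrite dPz andbT.
  have dk k : (d%:Z %| (k * P)%N%:Z)%Z by rewrite PoszM dvdz_mull.
  have -> : n'%:Z - n%:Z = ((n' + x' + (L - y')) - (n + x + (L - y)))%N%:Z
     - x'%:Z + y'%:Z + x%:Z - y%:Z by clear -uv yL yL'; lia.
  by rewrite xE yE xE' yE' !(rpredB, rpredD) // -xE -yE -xE' -yE'.
pose S n := \sum_(1 <= n' < N.+1 | ends n n') f n'.
have Sge n x y : (1 <= n <= N)%N -> x \in X -> y \in X -> S n <=
    \sum_(v < W.+1) smooth N f X L v * (E (n + x + (L - y))%N v)%:R.
  move=> nN xX yX.
  rewrite (smooth_sum R idfun N f X L W.+1 (fun v => (E (n + x + (L - y))%N v)%:R)) //=.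
  rewrite /S big_mkcond -(smooth_average N _ X X0) ler_wpM2l ?invr_ge0 ?sqr_ge0 //.
  rewrite [leLHS]big_nat [leRHS]big_nat; apply: ler_sum => n' nN'.
  rewrite [leLHS]big_seq [leRHS]big_seq; apply: ler_sum => x' x'X.
  rewrite [leLHS]big_seq [leRHS]big_seq; apply: ler_sum => y' y'X.
  case: ifP => [nr|_]; last by rewrite mulr_ge0 ?f0.
  by rewrite (nearE _ _ _ _ _ _ xX yX x'X y'X nr) mulr1.
have -> : \sum_(u < W.+1) \sum_(v < W.+1) (E u v)%:R * (smooth N f X L u * smooth N f X L v) =
   \sum_(u < W.+1) smooth N f X L u * \sum_(v < W.+1) smooth N f X L v * (E u v)%:R.
  apply: eq_bigr => u _; rewrite mulr_sumr; apply: eq_bigr => v _; ring.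
rewrite (smooth_sum R idfun N f X L W.+1
  (fun u => \sum_(v < W.+1) smooth N f X L v * (E u v)%:R)) //=.
apply: le_trans reg _.
have -> : \sum_(1 <= u < N.+1) \sum_(1 <= v < N.+1 | ends u v) f u * f v =
   \sum_(1 <= n < N.+1) f n * S n.
  by apply: eq_bigr => n _; rewrite /S mulr_sumr.
rewrite -(smooth_average N _ X X0) ler_wpM2l ?invr_ge0 ?sqr_ge0 //.
rewrite [leLHS]big_nat [leRHS]big_nat; apply: ler_sum => n nN.
rewrite [leLHS]big_seq [leRHS]big_seq; apply: ler_sum => x xX.
rewrite [leLHS]big_seq [leRHS]big_seq; apply: ler_sum => y yX.
by rewrite ler_wpM2l ?f0 // Sge.
Qed.

End Assembly.

Theorem theorem1p3 (R : realType) (delta kappa : R)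
  (hdelta : 0 < delta < 1) (hkappa : 0 < kappa < 1) :
  exists2 c : R, 0 < c &
  forall q K : R, 2 < q < 3 -> 0 < K ->
  exists (eta0 : R) (N0 : nat), 0 < eta0 /\
  forall (eta : R) (N : nat), 0 < eta <= eta0 -> (N0 <= N)%N ->
  let N1 := N./2 in
  let N2 := N./2 in
  let N3 := N in
  forall nu1 nu2 nu3 a1 a2 a3 : nat -> R,
  let alpha1 := mean N1 a1 in
  let alpha2 := mean N2 a2 in
  let alpha3 := mean N3 a3 in
  [/\ (forall n, (1 <= n <= N1)%N -> 0 <= a1 n <= nu1 n),
      (forall n, (1 <= n <= N2)%N -> 0 <= a2 n <= nu2 n) &
      (forall n, (1 <= n <= N3)%N -> 0 <= a3 n <= nu3 n)] ->
  [/\ delta <= alpha1, delta <= alpha2, delta <= alpha3 &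
      1 + delta <= (Num.min 1 (alpha1 + alpha2) + alpha2) / 2 + alpha3] ->
  [/\ pseudorandom N1 nu1 eta, pseudorandom N2 nu2 eta &
      pseudorandom N3 nu3 eta] ->
  [/\ extension_estimate N1 a1 q K, extension_estimate N2 a2 q K &
      extension_estimate N3 a3 q K] ->
  regular N1 a1 (delta / 50) kappa ->
  c * N%:R ^+ 2 <=
    \sum_(1 <= n1 < N1.+1) \sum_(1 <= n2 < N2.+1)
      \sum_(1 <= n3 < N3.+1 | (n1 + n2 + n3 == N)%N) a1 n1 * a2 n2 * a3 n3.
Proof.
have [c [rho [c0 /andP[r0 rd] [M0 dense]]]] := dense_functions R delta kappa hdelta hkappa.
have /andP[d0 d1] := hdelta.
(* The smoothed count is at least $cN_1^2\ge cN^2/9$, since $N\le3N_1$; half of this is conceded to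
   the smoothing error, which fixes $\gamma=c/(54K^q)$. *)
exists (c / 18) => [|q K qP K0]; first by rewrite divr_gt0.
have Kq0 : 0 < K `^ q by exact: powR_gt0.
have g0 : 0 < c / (54 * K `^ q) by rewrite divr_gt0 // mulr_gt0.
have [B B0 smoothing] := spectral_smoothing q K (c / (54 * K `^ q)) qP K0 g0.
have b0 : 0 < delta / 50 by rewrite divr_gt0.
pose P := primorial (delta / 50)^-1; have P0 : (0 < P)%N := primorial_gt0 _.
have P0R : 0 < P%:R :> R by rewrite ltr0n.
have B0R : 0 < B%:R :> R by rewrite ltr0n.
(* Since $|X|\ge\rho N_1/(2PB)$ and $N\le3N_1$, this bound on [eta] keeps the excess in [smooth_le]
   below [rho]. The threshold on [N] ensures $\rho N_1/P\ge1$, so that a positive [l] exists. *)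
exists (rho ^+ 2 / (6 * P%:R * B%:R)), (2 * (M0 + Num.truncn (P%:R / rho) + 2))%N.
split; first by rewrite divr_gt0 ?exprn_gt0 ?mulr_gt0.
move=> eta N /andP[eta0 etale] N0 N1 N2 N3 nu1 nu2 nu3 a1 a2 a3 alpha1 alpha2 alpha3.
move=> [a1nu a2nu a3nu] alphaP [pr1 pr2 pr3] [ext1 ext2 ext3] reg.
have half : (2 * N1 <= N <= (2 * N1).+1)%N by clear; rewrite /N1; lia.
have N1big : (M0 + Num.truncn (P%:R / rho)%R + 2 <= N1)%N by clear -N0; rewrite /N1; lia.
have N10 : (0 < N1)%N by apply: leq_trans N1big; rewrite addn2.
have NN : (0 < N)%N by apply: leq_trans N10 _; clear; rewrite /N1; lia.
have N1R : 0 < N1%:R :> R by rewrite ltr0n.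
have N1N : (N1 <= N)%N by clear; rewrite /N1; lia.
have NR0 : 0 < N%:R :> R by rewrite ltr0n.
have NR : N%:R <= 3 * N1%:R :> R.
  by rewrite -natrM ler_nat; clear -half N10; lia.
have [l [l0 llow lup _]] : exists l : nat, [/\ (0 < l)%N, rho * N1%:R / P%:R / 2 <= l%:R,
    l%:R <= rho * N1%:R / P%:R & rho * N1%:R / P%:R < l.+1%:R].
  apply: half_floor; rewrite ler_pdivlMr // mul1r mulrC -ler_pdivrMr //.
  have /andP[_ /ltW /le_trans] := truncn_itv (divr_ge0 (ltW P0R) (ltW r0)); apply.
  by rewrite ler_nat; apply: leq_trans N1big; rewrite addn2 ltnS leqW // leq_addl.
pose L := (P * l)%N.
have LR : L%:R <= rho * N1%:R.
  by move: lup; rewrite ler_pdivlMr // mulrC -natrM.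
have L100 : 100 * L%:R <= delta * N1%:R.
  have : rho * N1%:R <= delta / 100 * N1%:R by rewrite ler_wpM2r.
  clear -LR; lra.
have LN1 : (100 * L <= N1)%N.
  rewrite -(ler_nat R) natrM; apply: le_trans L100 _.
  by rewrite -[leRHS]mul1r ler_wpM2r // ltW.
have e1 : eta <= 1.
  apply: le_trans etale _; rewrite ler_pdivrMr ?mulr_gt0 // mul1r.
  apply: (@le_trans _ _ 1); first by rewrite expr_le1 ?(ltW r0) //; clear -rd d1; lra.
  by rewrite -!natrM ler1n !muln_gt0 P0 B0.
have a1pos n : (1 <= n <= N1)%N -> 0 <= a1 n by move=> /a1nu/andP[].
have a2pos n : (1 <= n <= N2)%N -> 0 <= a2 n by move=> /a2nu/andP[].
have a3pos n : (1 <= n <= N3)%N -> 0 <= a3 n by move=> /a3nu/andP[].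
have y1le theta : modulus (fourier N1 a1 theta) <= 2 * N%:R.
  apply: le_trans (modulus_fourier_le _ _ _ a1pos) _.
  apply: (@le_trans _ _ (\sum_(1 <= n < N1.+1) nu1 n)).
    rewrite big_nat [leRHS]big_nat; apply: ler_sum => n nN.
    by have /andP[] := a1nu n nN.
  apply: le_trans (pseudorandom_sum _ _ _ N10 pr1) _.
  by apply: ler_pM => //; rewrite ?ler_nat //; clear -eta0 e1; lra.
have [X [t [uX XP Xl err]]] :=
  smoothing N1 N2 N3 N P l a1 a2 a3 NN N1N N1N (leqnn N) P0 l0 ext1 ext2 ext3 y1le.
have X0 : (0 < size X)%N by case: (size X) Xl => //; rewrite mul0n leqNgt l0.
have XL : {in X, forall x, (x <= L)%N} by move=> x /XP/andP[].
have Xbig : rho * N1%:R <= (size X)%:R * (2 * P%:R * B%:R).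
  have : l%:R <= (size X)%:R * B%:R :> R by rewrite -natrM ler_nat.
  move=> /(le_trans llow); rewrite ler_pdivrMr // ler_pdivrMr //.
  by rewrite (_ : _ * 2 * _ = (size X)%:R * (2 * P%:R * B%:R)) //; ring.
have bound (M : nat) (f nu : nat -> R) k : (N1 <= M <= N)%N ->
    (forall n, (1 <= n <= M)%N -> 0 <= f n <= nu n) -> pseudorandom M nu eta ->
    0 <= smooth M f X L k <= 1 + rho.
  move=> /andP[M1 M2] fnu pr; apply/andP; split.
    by apply: smooth_ge0 => n /fnu/andP[].
  have LM : (L < M)%N by clear -LN1 M1 N10; lia.
  apply: le_trans (smooth_le _ _ _ _ _ k _ (leq_trans N10 M1) X0 uX XL LM fnu pr) _.
  rewrite lerD2l ler_pdivrMr ?ltr0n //.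
  apply: (@le_trans _ _ (rho ^+ 2 / (6 * P%:R * B%:R) * (3 * N1%:R))).
    apply: ler_pM => //; first exact: ltW.
    by apply: le_trans NR; rewrite ler_nat.
  have -> : rho ^+ 2 / (6 * P%:R * B%:R) * (3 * N1%:R) =
      rho * (rho * N1%:R / (2 * P%:R * B%:R)).
    by field; rewrite !gt_eqF.
  by rewrite ler_pM2l // ler_pdivrMr // !mulr_gt0.
have meanE (M : nat) (f : nat -> R) : (0 < M)%N -> \sum_(1 <= n < M.+1) f n = mean M f * M%:R.
  by move=> M0'; rewrite /mean divfK // pnatr_eq0 -lt0n.
have XP' : {in X, forall x, (x <= L)%N && (primorial (delta / 50)^-1 %| x)%N} by [].
have dense1 := dense N1 N L (smooth N1 a1 X L) (smooth N2 a2 X L) (smooth N3 a3 X L)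
  alpha1 alpha2 alpha3 (regular_edge (delta / 50) (N1 + 2 * L)).
have big : c * N1%:R ^+ 2 <= \sum_(x < (N1 + 2 * L).+1) \sum_(y < (N2 + 2 * L).+1)
     \sum_(z < (N3 + 3 * L).+1 | (x + y + z == N + 3 * L)%N)
       smooth N1 a1 X L x * smooth N2 a2 X L y * smooth N3 a3 X L z.
  apply: dense1 => //.
  - by apply: leq_trans N1big; rewrite -addnA leq_addr.
  - by split=> k; [apply: (bound _ _ nu1)|apply: (bound _ _ nu2)|apply: (bound _ _ nu3)];
      rewrite // /N2 /N3 ?leqnn ?N1N.
  - split; rewrite smooth_mass ?meanE //; rewrite /N3; clear; lia.
  - move=> u v vW /and3P[uv gap cop]; split => // p pp pdvd; rewrite ltNge; apply/negP => ple.
    have := dvdn_primorial _ _ pp ple => pP.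
    have := prime_gt1 pp; rewrite ltnNge => /negP; apply.
    rewrite -(eqP cop); apply: dvdn_leq; first by rewrite (eqP cop).
    by rewrite dvdn_gcd pdvd pP.
  apply: smooth_regular => //.
    by rewrite b0 /=; clear -d1; lra.
  by clear -L100; lra.
have M20 : (0 < 2 * N)%N by rewrite muln_gt0.
have C1 : (N < 2 * N)%N by clear -NN; lia.
have C2 : (N1 + N2 + N3 < N + 2 * N)%N by clear -NN; rewrite /N1 /N2 /N3; lia.
have C3 : (N + 3 * L < 2 * N)%N by clear -LN1 N10 N1N; lia.
have C4 : (N1 + 2 * L + (N2 + 2 * L) + (N3 + 3 * L) < N + 3 * L + 2 * N)%N.
  by clear -LN1 NN; rewrite /N2 /N3; move: LN1; rewrite /N1; lia.
have := smooth_triple_error N1 N2 N3 L N (2 * N) X a1 a2 a3 t M20 XL C1 C2 C3 C4.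
set Tb := \sum_(x < _) _ in big *; set Ta := \sum_(_ <= x < _) _.
move=> /le_trans /(_ err).
have -> : 6 * (c / (54 * K `^ q)) * K `^ q * N%:R ^+ 3 = (2 * N)%:R * (c / 18 * N%:R ^+ 2).
  by rewrite natrM; field; rewrite gt_eqF.
rewrite ler_pM2l ?ltr0n // => diff.
have : c * N%:R ^+ 2 <= c * (9 * N1%:R ^+ 2).
  rewrite ler_pM2l //; have -> : 9 * N1%:R ^+ 2 = (3 * N1%:R) ^+ 2 :> R by ring.
  by rewrite ler_sqr ?nnegrE // mulr_ge0.
clear -big diff; lra.
Qed.
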